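(* Let $P\to X$ be a principal $G$-bundle trivialized over a finite ordered open cover $\mathcal U=\{U_\alpha\}$ of $X$ with transition functions $g_{\alpha\beta}:U_\alpha\cap U_\beta\to G$, $g_{\alpha\gamma}=g_{\alpha\beta}g_{\beta\gamma}$. Then the map $$\phi_P:\Omega_G^*\to\check C^{*+1}(\mathcal U,\Omega_{DR}(U)),\qquad \phi_P(\omega)=\{\epsilon(\omega)1_{\alpha\beta}-g_{\alpha\beta}^*\omega\}_{\alpha\prec\beta}$$ is a twisting cochain, i.e. $\phi_P(1)=0$ and $$D\phi_P-\phi_P d-\phi_P\ast\phi_P=0.$$
   Context: $G$ is a compact algebraic Lie group, $X$ a closed smooth manifold. $G$ acts on $P$ from the left, $\varphi_\alpha:P|_{U_\alpha}\cong G\times U_\alpha$ are the chosen equivariant trivializations, and $\varphi_\beta\varphi_\alpha^{-1}(g,x)=(g\,g_{\alpha\beta}(x),x)$. $\Omega_G$ is the differential graded Hopf algebra of polynomial differential forms on $G$ with de Rham differential $d$, coproduct $\omega\mapsto\omega^{(1)}\otimes\omega^{(2)}$ induced by the product $G\times G\to G$ (for functions $f^{(1)}(g)f^{(2)}(h)=f(gh)$), counit $\epsilon$ = evaluation at the unit $e$ of the degree-$0$ part (zero on forms of positive degree), coaugmentation given by the constant function $1$. $\check C^n(\mathcal U,\Omega_{DR}(U))=\bigoplus_{p+q=n}\prod_{\alpha_0\prec\dots\prec\alpha_p}\Omega^q_{DR}(U_{\alpha_0\dots\alpha_p})$, $U_{\alpha_0\dots\alpha_p}=U_{\alpha_0}\cap\dots\cap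 U_{\alpha_p}$. With $(\delta h)_{\alpha_0\dots\alpha_{p+1}}=\sum_{i=0}^{p+1}(-1)^ih_{\alpha_0\dots\widehat{\alpha_i}\dots\alpha_{p+1}}$, the differential on the component of bidegree $(p,q)$ is $Dh=dh+(-1)^q\delta h$, and the product of $h'$ of Čech degree $p$ with $h''$ of Čech degree $p''$ and form degree $q''$ is $(h'\cup h'')_{\alpha_0\dots\alpha_{p+p''}}=(-1)^{pq''}h'_{\alpha_0\dots\alpha_p}\wedge h''_{\alpha_p\dots\alpha_{p+p''}}$ (restricted to $U_{\alpha_0\dots\alpha_{p+p''}}$). The family $1_{\alpha\beta}$ consists of the constant functions $1$ on $U_\alpha\cap U_\beta$. $(\phi\ast\phi)(\omega)=\sum(-1)^{|\omega^{(1)}|}\phi(\omega^{(1)})\cup\phi(\omega^{(2)})$. *)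

(* Defs.v *)
From HB Require Import structures.
From mathcomp Require Import all_boot all_order all_algebra.
From mathcomp Require Import all_classical all_reals all_analysis.

Set Implicit Arguments.
Unset Strict Implicit.
Unset Printing Implicit Defensive.

Import Order.TTheory GRing.Theory Num.Theory.
Import numFieldNormedType.Exports.

Local Open Scope classical_set_scope.
Local Open Scope ring_scope.

(* Manifolds are Hausdorff spaces with an atlas
   indexed by the points, the chart of index x being defined around x.  The
   tangent space at x is identified with R^n through the chart of index x, so
   that a differential form is a function of a point and a finite sequence of
   vectors of R^n.  Forms may be inhomogeneous: the degree q component of w is
   the restriction of w to sequences of size q. *)

Section Smooth.
Context {R : realType} {V W : normedModType R}.

Fixpoint Ck (k : nat) (U : set V) (f : V -> W) : Prop :=
  (forall x, U x -> {for x, continuous f}) /\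
  if k is k'.+1 then
    forall v, (forall x, U x -> derivable f x v) /\ Ck k' U ('D_v f)
  else True.

Definition smooth (U : set V) (f : V -> W) : Prop := forall k, Ck k U f.

End Smooth.

Record atlas (R : realType) (n : nat) (M : topologicalType) := Atlas {
  dom : M -> set M;
  chart : M -> M -> 'rV[R]_n;
  chartV : M -> 'rV[R]_n -> M }.

Definition form (R : realType) (n : nat) (M : Type) : Type :=
  M -> seq 'rV[R]_n -> R.

Definition omit (T : Type) (k : nat) (s : seq T) : seq T :=
  take k s ++ drop k.+1 s.

Section Manifold.
Context {R : realType} {n : nat} {M : topologicalType}.
Variable A : atlas R n M.

Record is_manifold : Prop := IsManifold {
  manifold_hausdorff : hausdorff_space M;
  dom_open : forall x, open (dom A x);
  dom_self : forall x, dom A x x;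
  img_open : forall x, open (chart A x @` dom A x);
  chart_cont : forall x y, dom A x y -> {for y, continuous (chart A x)};
  chartV_cont : forall x u,
    (chart A x @` dom A x) u -> {for u, continuous (chartV A x)};
  chartK : forall x y, dom A x y -> chartV A x (chart A x y) = y;
  chart_smooth : forall x y,
    smooth (chart A x @` (dom A x `&` dom A y)) (chart A y \o chartV A x) }.

Definition smooth_fun (W : normedModType R) (U : set M) (f : M -> W) : Prop :=
  forall x, smooth (chart A x @` (U `&` dom A x)) (f \o chartV A x).

Implicit Types (w : form R n M) (U : set M) (x : M) (s : seq 'rV[R]_n).

(* The expression of w in the chart of index x: at the point y of coordinates
   u, the vectors of s are moved from the chart x to the chart y by the
   differential of the change of coordinates. *)
Definition in_chart w x (u : 'rV[R]_n) s : R :=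
  let y := chartV A x u in
  w y [seq 'D_v (chart A y \o chartV A x) u | v <- s].

(* The space of forms on the open set U; a form on U is extended by 0, so that
   forms on U are equal if and only if they are equal as functions. *)
Record is_form U w : Prop := IsForm {
  form_supp : forall x s, ~ U x -> w x s = 0;
  form_linear : forall x s1 s2 (a : R) (u v : 'rV[R]_n),
    w x (s1 ++ (a *: u + v) :: s2)
      = a * w x (s1 ++ u :: s2) + w x (s1 ++ v :: s2);
  form_alt : forall x s1 s2 s3 (u : 'rV[R]_n),
    w x (s1 ++ u :: s2 ++ u :: s3) = 0;
  form_smooth : forall x s,
    smooth (chart A x @` (U `&` dom A x)) (in_chart w x ^~ s) }.

Definition is_homogeneous (q : nat) w : Prop :=
  forall x s, size s != q -> w x s = 0.

Definition restrict U w : form R n M := fun x s => \1_U x * w x s.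

Definition form_of_fun (f : M -> R) : form R n M :=
  fun x s => if s is [::] then f x else 0.

(* (dw)_x(v_0, ..., v_q) = \sum_k (-1)^k D_{v_k} w(v_0, ..^.., v_q), computed
   in the chart of index x, where the v_i extend to constant vector fields. *)
Definition ext_d w : form R n M := fun x s =>
  \sum_(k < size s)
     (-1) ^+ k * 'D_(s`_k) (in_chart w x ^~ (omit k s)) (chart A x x).

End Manifold.

Arguments restrict {R n M} U w.
Arguments form_of_fun {R n M} f.

(* The signature of the shuffle that moves the positions selected by m in front
   of the others. *)
Definition shuffle_sign (R : realType) (m : bitseq) : R :=
  (-1) ^+ (\sum_(j < size m) \sum_(i < j) (~~ nth true m i && nth false m j))%N.

Section Forms.
Context {R : realType} {n : nat} {M : topologicalType}.
Implicit Types w : form R n M.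

Definition wedge w1 w2 : form R n M := fun x s =>
  \sum_(m : (size s).-tuple bool)
     shuffle_sign R m * w1 x (mask m s) * w2 x (mask (map negb m) s).

(* Multiplication by (-1)^(k q) on the component of degree q. *)
Definition parity (k : nat) w : form R n M :=
  fun x s => (-1) ^+ (k * size s) * w x s.

End Forms.

Section Maps.
Context {R : realType} {m n : nat} {M N : topologicalType}.
Variables (A : atlas R m M) (B : atlas R n N).

Definition smooth_map (U : set M) (f : M -> N) : Prop :=
  (forall x, U x -> {for x, continuous f}) /\
  forall x y, smooth (chart A x @` (U `&` dom A x `&` f @^-1` dom B y))
                     (chart B y \o f \o chartV A x).

Definition tangent_map (f : M -> N) (x : M) (v : 'rV[R]_m) : 'rV[R]_n :=
  'D_v (chart B (f x) \o f \o chartV A x) (chart A x x).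

Definition pullback (f : M -> N) (w : form R n N) : form R m M :=
  fun x s => w (f x) (map (tangent_map f x) s).

Definition prod_atlas : atlas R (m + n) (M * N)%type := {|
  dom := fun p => dom A p.1 `*` dom B p.2;
  chart := fun p q => row_mx (chart A p.1 q.1) (chart B p.2 q.2);
  chartV := fun p u => (chartV A p.1 (lsubmx u), chartV B p.2 (rsubmx u)) |}.

End Maps.

(* Types with a topology and a group law, without compatibility condition. *)
#[short(type="spaceGroupType")]
HB.structure Definition SpaceGroup := {G of Topological G & Group G}.

(* Polynomial functions on N x N matrices. *)
Inductive polynomial_fun (R : realType) (N : nat) : ('M[R]_N -> R) -> Prop :=
| Poly_cst c : polynomial_fun (fun=> c)
| Poly_coord i j : polynomial_fun (fun a => a i j)
| Poly_add p q : polynomial_fun p -> polynomial_fun q ->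
    polynomial_fun (fun a => p a + q a)
| Poly_mul p q : polynomial_fun p -> polynomial_fun q ->
    polynomial_fun (fun a => p a * q a).

Section LieGroup.
Context {R : realType} {n N : nat} {G : spaceGroupType}.
Variables (A : atlas R n G) (rho : G -> 'M[R]_N).

Record is_lie_group : Prop := IsLieGroup {
  lie_manifold : is_manifold A;
  lie_mul : smooth_map (prod_atlas A A) A setT (fun p => (p.1 * p.2)%g);
  lie_inv : smooth_map A A setT (fun x => (x^-1)%g) }.

(* rho identifies G with a Zariski closed subgroup of GL_N(R). *)
Record is_algebraic : Prop := IsAlgebraic {
  algebraic_smooth : smooth_fun A setT rho;
  algebraic1 : rho 1%g = 1%:M;
  algebraicM : forall x y, rho (x * y)%g = rho x *m rho y;
  algebraic_inj : injective rho;
  algebraic_closed : range rho =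
    [set a | a \in unitmx /\
       forall p, polynomial_fun p -> (forall x, p (rho x) = 0) -> p a = 0] }.

Definition regular (f : G -> R) : Prop :=
  exists p k, polynomial_fun p /\ forall x, f x = p (rho x) / \det (rho x) ^+ k.

(* Omega_G: the differential graded subalgebra of the de Rham algebra of G
   generated by the regular functions. *)
Inductive polynomial_form : form R n G -> Prop :=
| Pform_fun f : regular f -> polynomial_form (form_of_fun f)
| Pform_add w1 w2 : polynomial_form w1 -> polynomial_form w2 ->
    polynomial_form (w1 + w2)
| Pform_wedge w1 w2 : polynomial_form w1 -> polynomial_form w2 ->
    polynomial_form (wedge w1 w2)
| Pform_d w : polynomial_form w -> polynomial_form (ext_d A w).

Definition counit (w : form R n G) : R := w 1%g [::].

(* s represents the element \sum_i s_i.1 (x) s_i.2 of Omega_G (x) Omega_G which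
   corresponds to the pullback of w by the product of G under the injection
   a (x) b |-> pr1^*a /\ pr2^*b into the forms on G * G. *)
Definition is_coproduct (w : form R n G) (s : seq (form R n G * form R n G)) :=
  (forall t, t \in s -> polynomial_form t.1 /\ polynomial_form t.2) /\
  pullback (prod_atlas A A) A (fun p => (p.1 * p.2)%g) w
    = \sum_(t <- s) wedge (pullback (prod_atlas A A) A fst t.1)
                          (pullback (prod_atlas A A) A snd t.2).

Definition coproduct (w : form R n G) : seq (form R n G * form R n G) :=
  xget [::] (is_coproduct w).

End LieGroup.

Section Cech.
Context {R : realType} {n : nat} {X : topologicalType}.
Context {disp : Order.disp_t} {I : finOrderType disp}.
Variables (A : atlas R n X) (U : I -> set X).

(* The value of a cochain at [:: a_0; ...; a_p] is its component on
   U_{a_0 ... a_p}. *)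
Definition cochain : Type := seq I -> form R n X.

Implicit Types (h : cochain) (t : seq I).

Definition is_simplex t : bool := (t != [::]) && sorted <%O t.

Definition overlap t : set X := [set x | forall a, a \in t -> U a x].

(* The space of cochains of total degree k. *)
Definition is_cochain (k : nat) h : Prop :=
  (forall t, ~~ is_simplex t -> h t = 0) /\
  forall t, is_simplex t ->
    is_form A (overlap t) (h t) /\
    forall x s, ((size t).-1 + size s)%N != k -> h t x s = 0.

Definition cech_delta h : cochain := fun t =>
  if is_simplex t then
    restrict (overlap t) (\sum_(i < size t) (-1) ^+ i *: h (omit i t))
  else 0.

(* (-1)^q is applied by parity, as delta preserves the form degree q. *)
Definition cech_D h : cochain := fun t =>
  restrict (overlap t) (ext_d A (h t)) + parity 1 (cech_delta h t).

Definition cup h1 h2 : cochain := fun t =>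
  restrict (overlap t)
    (\sum_(p < size t) wedge (h1 (take p.+1 t)) (parity p (h2 (drop p t)))).

End Cech.

Section Twisting.
Context {R : realType} {nG nX N : nat} {G : spaceGroupType}.
Context {X : topologicalType} {disp : Order.disp_t} {I : finOrderType disp}.
Variables (AG : atlas R nG G) (rho : G -> 'M[R]_N).
Variables (AX : atlas R nX X) (U : I -> set X).

Notation cochainX := (@cochain R nX X disp I).
Implicit Type phi : form R nG G -> cochainX.

(* As phi is linear, parity 1 accounts for the sign of the homogeneous
   components of the first factor, and the sum does not depend on the
   representative of the coproduct. *)
Definition convolution phi1 phi2 : form R nG G -> cochainX := fun w =>
  \sum_(t <- coproduct AG rho w) cup U (phi1 (parity 1 t.1)) (phi2 t.2).

Record is_twisting_cochain phi : Prop := IsTwistingCochain {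
  twisting_linear : forall (a : R) w1 w2,
    polynomial_form AG rho w1 -> polynomial_form AG rho w2 ->
    phi (a *: w1 + w2) = a *: phi w1 + phi w2;
  twisting_degree : forall q w,
    polynomial_form AG rho w -> is_homogeneous q w ->
    is_cochain AX U q.+1 (phi w);
  twisting1 : phi (form_of_fun (fun=> 1)) = 0;
  twisting_eq : forall w, polynomial_form AG rho w ->
    cech_D AX U (phi w) - phi (ext_d AG w) - convolution phi phi w = 0 }.

Definition phi_P (g : I -> I -> X -> G) : form R nG G -> cochainX := fun w t =>
  if t is [:: a; b] then
    if (a < b)%O then
      restrict (U a `&` U b)
        (form_of_fun (fun=> counit w) - pullback AX AG (g a b) w)
    else 0
  else 0.

End Twisting.

Section Bundle.
Context {R : realType} {nG nX nP : nat} {G : spaceGroupType}.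
Context {X P : topologicalType} {I : Type}.
Variables (AG : atlas R nG G) (AX : atlas R nX X) (AP : atlas R nP P).
Variables (pr : P -> X) (act : G -> P -> P) (U : I -> set X).
Variables (triv : I -> P -> G * X) (trivV : I -> G * X -> P).

(* triv a is an equivariant diffeomorphism of the part of P over U a onto
   G * U a, over U a, with inverse trivV a. *)
Record is_principal_bundle : Prop := IsPrincipalBundle {
  total_manifold : is_manifold AP;
  proj_smooth : smooth_map AP AX setT pr;
  act_smooth : smooth_map (prod_atlas AG AP) AP setT (fun z => act z.1 z.2);
  act1 : forall p, act 1%g p = p;
  actM : forall g h p, act (g * h)%g p = act g (act h p);
  proj_act : forall g p, pr (act g p) = pr p;
  cover_open : forall a, open (U a);
  cover_full : forall x, exists a, U a x;
  triv_smooth : forall a,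
    smooth_map AP (prod_atlas AG AX) (pr @^-1` U a) (triv a);
  trivV_smooth : forall a,
    smooth_map (prod_atlas AG AX) AP (setT `*` U a) (trivV a);
  triv_proj : forall a p, U a (pr p) -> (triv a p).2 = pr p;
  trivV_proj : forall a h x, U a x -> pr (trivV a (h, x)) = x;
  trivK : forall a p, U a (pr p) -> trivV a (triv a p) = p;
  trivVK : forall a h x, U a x -> triv a (trivV a (h, x)) = (h, x);
  triv_act : forall a g p, U a (pr p) ->
    triv a (act g p) = ((g * (triv a p).1)%g, pr p) }.

Definition is_transition (g : I -> I -> X -> G) : Prop :=
  forall a b h x, U a x -> U b x ->
    triv b (trivV a (h, x)) = ((h * g a b x)%g, x).

End Bundle.

(* Main.v *)
Require Import Defs.
From HB Require Import structures.
From mathcomp Require Import all_boot all_order all_algebra.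
From mathcomp Require Import all_classical all_reals all_analysis.
From mathcomp Require Import ring lra zify.
Set Implicit Arguments.
Unset Strict Implicit.
Unset Printing Implicit Defensive.
Import Order.TTheory GRing.Theory Num.Theory.
Import numFieldNormedType.Exports.
Local Open Scope classical_set_scope.
Local Open Scope ring_scope.

(* The differential forms take precedence over the bilinear forms of the same
   name. *)
Import Defs.

(** The cochain phi w lives on the edges of the cover, so the twisting equation
   only has content on edges and on triangles.

   On an edge a < b it says that d (eps w - g_ab^* w) = eps (d w) - g_ab^* (d w).
   Constants are closed and the counit eps vanishes on exact forms, so this is
   the naturality of d.  On a triangle a < b < c all signs combine to one common
   sign, and the equation becomes
     sum (eps w' - g_ab^* w') /\ (eps w'' - g_bc^* w'')
       = eps w - g_bc^* w - g_ab^* w + g_ac^* w,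
   the sum being over the coproduct w' (x) w'' of w.  The coproduct represents
   the pullback of w by the multiplication of G, hence pulling it back along a
   pair of maps (f1, f2) to G gives sum f1^* w' /\ f2^* w'' = (f1 f2)^* w
   ([coproduct_pullback]).  The four terms are the cases where f1 is g_ab or the
   constant 1 and f2 is g_bc or the constant 1, because pulling back along the
   constant 1 is the counit ([pullback_unit]) and because g_ab g_bc = g_ac
   ([coproduct_transition]).

   Two facts about polynomial forms carry the argument.  The first is that d
   commutes with pullbacks.  Rather than differentiating the pullback of a form
   of arbitrary degree, one considers the forms for which d commutes with the
   pullback along every smooth map from an open subset of a Euclidean space
   ([natural]).  They contain the smooth functions by the chain rule, they are
   closed under wedge products by Leibniz' rule, and they are closed under d
   because d d = 0; so they contain the polynomial forms.  The second is that a
   coproduct exists ([coproductP]).  It is constructed in the same way, from the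
   coproduct of a polynomial in the entries of a matrix, with Leibniz' rule for
   d and with graded commutativity to interchange the two middle factors in the
   product of two coproducts.

   Both rest on the calculus of forms with constant arguments.  Interior
   multiplication by a constant vector is a derivation of the wedge product
   ([contr_wedge]) and satisfies Cartan's formula ([contr_eucl_d]); associativity,
   graded commutativity, Leibniz' rule and d d = 0 are then inductions on the
   number of arguments, the last one by the symmetry of second derivatives
   ([deriveC]).  The chain rule and the stability of smooth maps under
   composition rest on the fact that functions with continuous partial
   derivatives are differentiable ([C1_differentiable]). *)

(** * Derivatives along lines *)

Section Lines.
Context {R : realType} {V W : normedModType R}.
Implicit Types (f : V -> W) (x y v w : V).

(** The difference quotients along a line are, term by term, those of the
   directional derivative, so that one-variable calculus applies on lines. *)
Lemma growth_line f y w (t : R) :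
  (fun h : R => h^-1 *: (((fun s : R => f (y + s *: w)) \o shift t) (h *: 1)
      - f (y + t *: w)))
  = (fun h : R => h^-1 *: ((f \o shift (y + t *: w)) (h *: w) - f (y + t *: w))).
Proof.
apply/funext => h /=; congr (_ *: (f _ - _)).
by rewrite [h *: 1]mulr1 scalerDl addrCA.
Qed.

Lemma derivable_line f y w (t : R) :
  derivable (fun s : R => f (y + s *: w)) t 1 = derivable f (y + t *: w) w.
Proof. by rewrite /derivable growth_line. Qed.

Lemma derive_line f y w (t : R) :
  'D_1 (fun s : R => f (y + s *: w)) t = 'D_w f (y + t *: w).
Proof. by rewrite /derive growth_line. Qed.

Lemma derive_scale_dir f x v (a : R) :
  derivable f x v -> derivable f x (a *: v) /\ 'D_(a *: v) f x = a *: 'D_v f x.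
Proof.
move=> fv.
pose phi := fun s : R => f (x + s *: v).
have x0 w : x = x + (0 : R) *: w by rewrite scale0r addr0.
have phiE : derivable phi 0 1 by rewrite /phi derivable_line -x0.
have dphi : differentiable phi (a * 0) by rewrite mulr0; exact/derivable1_diffP.
have dmul : is_derive (0 : R) (1 : R) ( *%R a) a.
  have -> : ( *%R a) = a \*: (@id R) by apply/funext.
  by apply: is_derive_eq; rewrite /GRing.scale /= mulr1.
have dm : differentiable ( *%R a) (0 : R) by apply/derivable1_diffP; apply: ex_derive.
have E : (fun s : R => f (x + s *: (a *: v))) = phi \o ( *%R a).
  by apply/funext => s; rewrite /phi /= scalerA mulrC.
have dc := differentiable_comp dm dphi.
split; first by rewrite [X in derivable _ X](x0 (a *: v)) -derivable_line E; exact/derivable1_diffP.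
rewrite [in LHS](x0 (a *: v)) -derive_line E deriveE // diff_comp //=.
have -> : 'd ( *%R a) 0 1 = a by rewrite -(deriveE _ dm) derive_val.
move: dphi; rewrite mulr0 => dphi.
rewrite (deriv1E phiE) derive1E [in RHS](x0 v) -derive_line.
by [].
Qed.

End Lines.

(** * Mean values and the symmetry of second derivatives *)

Section MeanValue.
Context {R : realType} {V : normedModType R}.
Implicit Types (f : V -> R) (x y v w : V).

Lemma mvt_line f y w :
  (forall t, 0 <= t <= 1 -> derivable f (y + t *: w) w) ->
  exists2 c : R, 0 <= c <= 1 & f (y + w) - f y = 'D_w f (y + c *: w).
Proof.
move=> df; pose phi := fun t : R => f (y + t *: w).
have dphi t : t \in `[0, 1] -> derivable phi t 1.
  by rewrite in_itv /= /phi derivable_line => /df.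
have [||| c cI] := @MVT_segment R phi (fun t => 'D_1 phi t) 0 1.
- exact: ler01.
- by move=> t tI; apply: derivableP; apply: dphi; apply: subset_itv_oo_cc tI.
- exact: derivable_within_continuous.
rewrite /phi derive_line scale1r scale0r addr0 subr0 mulr1 => e.
by exists c => //; move: cI; rewrite in_itv.
Qed.

(** Both mixed second differences along the parallelogram spanned by [r *: v]
   and [r *: w] are mixed derivatives at intermediate points, and continuity
   lets the parallelogram shrink to its corner. *)
Lemma deriveC (f : V -> R) x v w :
  (\forall y \near x, derivable f y v) ->
  (\forall y \near x, derivable f y w) ->
  (\forall y \near x, derivable ('D_v f) y w) ->
  (\forall y \near x, derivable ('D_w f) y v) ->
  {for x, continuous ('D_w ('D_v f))} -> {for x, continuous ('D_v ('D_w f))} ->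
  'D_w ('D_v f) x = 'D_v ('D_w f) x.
Proof.
(* By symmetry only one of the two computations of the second difference is
   needed: first a mean value along v', then one along w'. *)
have half v' w' (e : R) : 0 < e -> (\forall y \near x, derivable f y v') ->
    (\forall y \near x, derivable ('D_v' f) y w') ->
    {for x, continuous ('D_w' ('D_v' f))} ->
    \forall r \near (0 : R), r != 0 ->
     `|(f (x + r *: v' + r *: w') - f (x + r *: v') - f (x + r *: w') + f x) / r ^+ 2
      - 'D_w' ('D_v' f) x| < e.
  move=> e0 d1 d2 cts.
  have [d d0 dP] : exists2 d : R, 0 < d & forall y, `|x - y| < d ->
      [/\ derivable f y v', derivable ('D_v' f) y w'
        & `|'D_w' ('D_v' f) x - 'D_w' ('D_v' f) y| < e].
    have : \forall y \near x, [/\ derivable f y v', derivable ('D_v' f) y w'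
        & `|'D_w' ('D_v' f) x - 'D_w' ('D_v' f) y| < e].
      have d3 : \forall y \near x, `|'D_w' ('D_v' f) x - 'D_w' ('D_v' f) y| < e.
        by move/cvgrPdist_lt: cts => /(_ _ e0).
      by apply: filterS3 d1 d2 d3 => y.
    by case/nbhs_normP => d /= d0 H; exists d => // y; apply: H.
  (* for |r| < d / K the whole parallelogram lies in the ball of radius d; the
     summand 1 keeps K positive *)
  pose K := `|v'| + `|w'| + 1.
  have K0 : 0 < K by rewrite /K; have := normr_ge0 v'; have := normr_ge0 w'; lra.
  have near_pt (r s t : R) : `|r| < d / K -> 0 <= s <= 1 -> 0 <= t <= 1 ->
      `|x - (x + s *: (r *: v') + t *: (r *: w'))| < d.
    move=> rd /andP[s0 s1] /andP[t0 t1].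
    rewrite -addrA opprD addrA subrr add0r normrN !scalerA.
    apply: le_lt_trans (ler_normD _ _) _; rewrite !normrZ.
    rewrite (ger0_norm s0) (ger0_norm t0).
    have rK : `|r| * K < d by rewrite -ltr_pdivlMr.
    apply: le_lt_trans rK; rewrite /K.
    have r0 := normr_ge0 r; have v0 := normr_ge0 v'; have w0 := normr_ge0 w'.
    have a1 : s * `|r| * `|v'| <= `|r| * `|v'|.
      by apply: ler_wpM2r => //; rewrite ler_piMl.
    have a2 : t * `|r| * `|w'| <= `|r| * `|w'|.
      by apply: ler_wpM2r => //; rewrite ler_piMl.
    nra.
  have r_small : \forall r \near (0 : R), `|r| < d / K.
    have dK : 0 < d / K by rewrite divr_gt0.
    by near=> r; rewrite -[r]subr0 distrC; near: r; apply/nbhs_normP; exists (d / K).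
  near=> r => r0.
  have rd : `|r| < d / K by near: r.
  have i01 : 0 <= (0 : R) <= 1 by rewrite lexx ler01.
  have i11 : 0 <= (1 : R) <= 1 by rewrite ler01 lexx.
  have dv s t : 0 <= s <= 1 -> 0 <= t <= 1 ->
      derivable f (x + s *: (r *: v') + t *: (r *: w')) v'.
    by move=> hs ht; have [] := dP _ (near_pt r s t rd hs ht).
  pose h y := f (y + r *: w') - f y.
  have dh s : 0 <= s <= 1 -> is_derive (x + s *: (r *: v')) (r *: v') h
     (r * ('D_v' f (x + s *: (r *: v') + r *: w') - 'D_v' f (x + s *: (r *: v')))).
    move=> hs.
    have e1 : derivable f (x + s *: (r *: v') + r *: w') v'.
      by have := dv s 1 hs i11; rewrite scale1r.
    have e2 : derivable f (x + s *: (r *: v')) v'.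
      by have := dv s 0 hs i01; rewrite scale0r addr0.
    have [e1' e1d] := derive_scale_dir r e1.
    have [e2' e2d] := derive_scale_dir r e2.
    have gE : (fun k : R => k^-1 *: (((fun y => f (y + r *: w')) \o
         shift (x + s *: (r *: v'))) (k *: (r *: v'))
         - f (x + s *: (r *: v') + r *: w'))) =
       (fun k : R => k^-1 *: ((f \o shift (x + s *: (r *: v') + r *: w')) (k *: (r *: v'))
         - f (x + s *: (r *: v') + r *: w'))).
      by apply/funext => k /=; rewrite -[in LHS]addrA.
    have e3 : is_derive (x + s *: (r *: v')) (r *: v') (fun y => f (y + r *: w'))
        ('D_(r *: v') f (x + s *: (r *: v') + r *: w')).
      by split; [rewrite /derivable gE | rewrite /derive gE].
    have e4 : is_derive (x + s *: (r *: v')) (r *: v') f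
        ('D_(r *: v') f (x + s *: (r *: v'))) by apply: derivableP.
    have e5 := is_deriveB e3 e4.
    by apply: is_derive_eq; rewrite e1d e2d mulrBr.
  have [s hs sE] := @mvt_line h x (r *: v') (fun s hs => let: DeriveDef e _ := dh s hs in e).
  have [t ht|t ht tE] := @mvt_line ('D_v' f) (x + s *: (r *: v')) (r *: w').
    have [_ H _] := dP _ (near_pt r s t rd hs ht).
    by have [] := derive_scale_dir r H.
  have [_ D2 lt_e] := dP _ (near_pt r s t rd hs ht).
  have -> : f (x + r *: v' + r *: w') - f (x + r *: v') - f (x + r *: w') + f x
      = h (x + r *: v') - h x by rewrite /h; ring.
  rewrite sE; have := dh s hs => dhs; rewrite derive_val tE.
  have [_ ->] := derive_scale_dir r D2.
  set D := 'D_w' ('D_v' f) (x + _ + _) in lt_e *.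
  have -> : r * (r *: D) / r ^+ 2 = D by rewrite /GRing.scale /=; field.
  by rewrite distrC.
move=> dv dw dvw dwv cvw cwv; apply/eqP; rewrite -subr_eq0 -normr_le0.
apply/ler_addgt0Pl => e e0; rewrite addr0.
have e2 : 0 < e / 2 by rewrite divr_gt0.
have H1 := half v w _ e2 dv dvw cvw.
have H2 := half w v _ e2 dw dwv cwv.
have [r [r0 h1 h2]] : exists r : R, [/\ r != 0,
  `|(f (x + r *: v + r *: w) - f (x + r *: v) - f (x + r *: w) + f x) / r ^+ 2
      - 'D_w ('D_v f) x| < e / 2 &
  `|(f (x + r *: w + r *: v) - f (x + r *: w) - f (x + r *: v) + f x) / r ^+ 2
      - 'D_v ('D_w f) x| < e / 2].
  move: H1 => /nbhs_normP[d1 /= d10 H1]; move: H2 => /nbhs_normP[d2 /= d20 H2].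
  pose r := Num.min d1 d2 / 2.
  have r0 : 0 < r by rewrite divr_gt0 // lt_min d10 d20.
  have [r1 r2] : r < d1 /\ r < d2.
    by split; rewrite ltr_pdivrMr // gt_min; apply/orP; [left|right]; lra.
  have rN : `|0 - r| = r by rewrite sub0r normrN gtr0_norm.
  exists r; split; first exact: lt0r_neq0.
    by apply: H1; [rewrite /ball_ /= rN | exact: lt0r_neq0].
  by apply: H2; [rewrite /ball_ /= rN | exact: lt0r_neq0].
(* The second difference is symmetric in v and w. *)
have swap : f (x + r *: w + r *: v) - f (x + r *: w) - f (x + r *: v) + f x
   = f (x + r *: v + r *: w) - f (x + r *: v) - f (x + r *: w) + f x.
  by rewrite [x + r *: w + r *: v]addrAC; ring.
rewrite swap in h2.
set q := _ / r ^+ 2 in h1 h2.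
set A := 'D_w _ _ in h1 *; set B := 'D_v _ _ in h2 *.
have -> : A - B = (q - B) - (q - A) by ring.
apply: le_trans (ler_normB _ _) _.
by rewrite (splitr e); apply: lerD; [move: h2 | move: h1]; exact: ltW.
Unshelve. all: by end_near. Qed.

End MeanValue.

(** * Differentiability from continuous partial derivatives *)

Section Frechet.
Context {R : realType}.

Lemma coord_le_norm m n (a : 'M[R]_(m, n)) i j : `|a i j| <= `|a|.
Proof.
rewrite [leRHS]/Num.Def.normr /= mx_normrE.
exact: (le_bigmax _ (fun ij : 'I_m * 'I_n => `|a ij.1 ij.2|) (i, j)).
Qed.

Lemma norm_le_coord m n (a : 'M[R]_(m, n)) (e : R) :
  0 <= e -> (forall i j, `|a i j| <= e) -> `|a| <= e.
Proof.
by move=> e0 H; rewrite [leLHS]/Num.Def.normr /= mx_normrE bigmax_le // => -[].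
Qed.

Lemma continuous_mx (T : topologicalType) m n (f : T -> 'M[R]_(m, n)) x :
  (forall i j, {for x, continuous (fun y => f y i j)}) -> {for x, continuous f}.
Proof.
move=> H; apply/cvgrPdist_le => e e0.
have He : \forall y \near x, forall i j, `|f x i j - f y i j| <= e.
  apply: filter_forall => i; apply: filter_forall => j.
  by have /cvgrPdist_le /(_ _ e0) := H i j.
apply: filterS He => y Hy.
by apply: norm_le_coord => [|i j]; [exact: ltW | rewrite !mxE].
Qed.

Lemma continuous_mxE (T : topologicalType) m n (f : T -> 'M[R]_(m, n)) x i j :
  {for x, continuous f} -> {for x, continuous (fun y => f y i j)}.
Proof.
move=> H; apply: (@continuous_comp _ _ _ f (fun a : 'M[R]_(m, n) => a i j) x H).
exact: coord_continuous.
Qed.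

Section Scalar.
Context {n : nat}.
Implicit Types (f : 'rV[R]_n -> R) (x h : 'rV[R]_n).

(** The corners of the path from 0 to [h] along the coordinate axes. *)
Definition trunc k h : 'rV[R]_n := \row_i (if (i < k)%N then h 0 i else 0).

Lemma trunc0 h : trunc 0 h = 0.
Proof. by apply/rowP => i; rewrite !mxE. Qed.

Lemma trunc_full h : trunc n h = h.
Proof. by apply/rowP => i; rewrite !mxE ltn_ord. Qed.

Lemma truncS (k : 'I_n) h : trunc k.+1 h = trunc k h + h 0 k *: 'e_k.
Proof.
apply/rowP => i; rewrite !mxE eqxx /= ltnS leq_eqVlt.
have [->|ik] := eqVneq i k; first by rewrite eqxx ltnn mulr1 add0r.
by rewrite mulr0 addr0 -[_ == _ :> nat]/(i == k) (negbTE ik).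
Qed.

Definition partials f x h : R := \sum_i h 0 i * 'D_('e_i) f x.

Lemma partials_continuous f x : continuous (partials f x).
Proof.
apply: continuous_big => [|i _ h]; first exact: add_continuous.
apply: (@continuousM _ _ (fun h : 'rV[R]_n => h 0 i) (cst ('D_('e_i) f x)) h).
  exact: coord_continuous.
exact: cst_continuous.
Qed.

Lemma partials_linear f x : linear (partials f x).
Proof.
move=> a u v; rewrite /partials /GRing.scale /= mulr_sumr -big_split /=.
by apply: eq_bigr => i _; rewrite !mxE mulrDl mulrA.
Qed.

(** The increment is telescoped along the coordinate axes and each step is
   estimated by the mean value theorem. *)
Lemma C1_partials f x :
  (forall i, \forall y \near x, derivable f y 'e_i) ->
  (forall i, {for x, continuous ('D_('e_i) f)}) ->
  f \o shift x = cst (f x) + partials f x +o_ (0 : 'rV[R]_n) id.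
Proof.
move=> df cf; apply/eqaddoP => e e0.
(* the n steps share the error; n + 1 avoids a division by zero *)
pose e' := e / n.+1%:R.
have e'0 : 0 < e' by rewrite divr_gt0.
have [d d0 dP] : exists2 d : R, 0 < d & forall y, `|x - y| < d ->
   forall i, derivable f y 'e_i /\ `|'D_('e_i) f x - 'D_('e_i) f y| < e'.
  have ci i : \forall y \near x,
      derivable f y 'e_i /\ `|'D_('e_i) f x - 'D_('e_i) f y| < e'.
    have c : \forall y \near x, `|'D_('e_i) f x - 'D_('e_i) f y| < e'.
      by have /cvgrPdist_lt /(_ _ e'0) := cf i.
    by apply: filterS2 (df i) c => y.
  have : \forall y \near x, forall i,
      derivable f y 'e_i /\ `|'D_('e_i) f x - 'D_('e_i) f y| < e'.
    exact: filter_forall (nbhs_filter x) ci.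
  by case/nbhs_normP => d /= d0 H; exists d => // y; apply: H.
have step h (k : 'I_n) : `|h| < d ->
   `|f (x + trunc k.+1 h) - f (x + trunc k h) - h 0 k * 'D_('e_k) f x| <= e' * `|h|.
  move=> hd.
  have pt (c : R) : 0 <= c <= 1 -> `|x - (x + trunc k h + c *: (h 0 k *: 'e_k))| < d.
    move=> /andP[c0 c1]; apply: le_lt_trans hd.
    rewrite -addrA opprD addrA subrr add0r normrN.
    apply: norm_le_coord => // i j; rewrite !mxE [i]ord1 eqxx /=.
    have [->|jk] := eqVneq j k.
      rewrite ltnn add0r mulr1 normrM ger0_norm //.
      by apply: le_trans (coord_le_norm _ 0 k); rewrite ler_piMl.
    rewrite !mulr0 addr0; case: ifP => _; last by rewrite normr0.
    exact: coord_le_norm.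
  have [c c01] : exists2 c : R, 0 <= c <= 1 &
      f (x + trunc k h + h 0 k *: 'e_k) - f (x + trunc k h)
      = 'D_(h 0 k *: 'e_k) f (x + trunc k h + c *: (h 0 k *: 'e_k)).
    apply: mvt_line => t /pt /dP /(_ k)[H _].
    by have [] := derive_scale_dir (h 0 k) H.
  have [D1 D2] := dP _ (pt _ c01) k.
  have [_ ->] := derive_scale_dir (h 0 k) D1.
  rewrite truncS addrA => ->.
  rewrite -[_ *: _]/(_ * _) -mulrBr normrM distrC mulrC.
  by apply: ler_pM => //; [exact: ltW | exact: coord_le_norm].
apply: filterS (@nbhs0_lt _ 'rV[R]_n _ d0) => h hd.
have -> : (f \o shift x - (cst (f x) + partials f x)) h =
   \sum_(k < n) (f (x + trunc k.+1 h) - f (x + trunc k h) - h 0 k * 'D_('e_k) f x).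
  rewrite sumrB -(big_mkord xpredT (fun k => f (x + trunc k.+1 h) - f (x + trunc k h))).
  rewrite telescope_sumr // trunc_full trunc0 addr0.
  rewrite -[LHS]/(f (h + x) - (f x + partials f x h)) /partials addrC [h + x]addrC.
  lra.
apply: le_trans (ler_norm_sum _ _ _) _.
apply: le_trans (ler_sum _ (fun k _ => step h k hd)) _.
rewrite sumr_const card_ord -mulr_natl mulrA ler_wpM2r // /e' mulrCA.
by rewrite ler_piMr ?(ltW e0) // ler_pdivrMr // mul1r ler_nat.
Qed.

Lemma C1_differentiable f x :
  (forall i, \forall y \near x, derivable f y 'e_i) ->
  (forall i, {for x, continuous ('D_('e_i) f)}) -> differentiable f x.
Proof.
move=> df cf.
pose L : {linear 'rV[R]_n -> R} :=
  HB.pack (partials f x) (GRing.isLinear.Build _ _ _ _ _ (partials_linear f x)).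
have e := C1_partials df cf.
have dE : 'd f x = partials f x :> (_ -> _).
  by apply: (@diff_unique _ _ _ f L) => //; exact: partials_continuous.
by apply/diff_locallyP; rewrite dE; split => //; exact: partials_continuous.
Qed.

End Scalar.

(** Componentwise, a matrix valued function is a combination of constant
   matrices with differentiable coefficients. *)
Lemma differentiable_mx n p q (f : 'rV[R]_n -> 'M[R]_(p, q)) x :
  (forall i j, differentiable (fun y => f y i j) x) -> differentiable f x.
Proof.
move=> H.
have -> : f = \sum_i \sum_j (fun y => f y i j *: delta_mx i j).
  apply/funext => y; rewrite [LHS]matrix_sum_delta fct_sumE.
  by apply: eq_bigr => i _; rewrite fct_sumE.
by apply: differentiable_sum => i; apply: differentiable_sum => j; exact: differentiableZl.
Qed.

End Frechet.

(** * Functions of class C^k *)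

Section CkGeneral.
Context {R : realType} {V W : normedModType R}.
Implicit Types (U : set V) (f g : V -> W).

Lemma Ck_sub k U U' f : U' `<=` U -> Ck k U f -> Ck k U' f.
Proof.
move=> sU; elim: k f => [|k IH] f [cf df]; split=> //; try by move=> x /sU /cf.
by move=> v; have [dv Cv] := df v; split; [move=> x /sU /dv | exact: IH].
Qed.

Lemma Ck_continuous k U f x : Ck k U f -> U x -> {for x, continuous f}.
Proof. by case: k => [|k] [cf _] /cf. Qed.

Lemma CkW k U f : Ck k.+1 U f -> Ck k U f.
Proof.
elim: k f => [|k IH] f [cf df]; split=> // v.
by have [dv Cv] := df v; split => //; exact: IH.
Qed.

Lemma Ck_C1 k U f : Ck k.+1 U f -> Ck 1 U f.
Proof. by elim: k => // k IH /CkW/IH. Qed.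

(** The derivatives are those of a function on the whole space, so agreement on
   [U] passes to them only because [U] is open. *)
Lemma Ck_ext k U f g : open U -> (forall x, U x -> f x = g x) -> Ck k U f -> Ck k U g.
Proof.
move=> oU; have near_fg f' g' x : (forall x, U x -> f' x = g' x) -> U x ->
    \forall y \near x, f' y = g' y :> W.
  by move=> fg Ux; apply: filterS (open_nbhs_nbhs (conj oU Ux)) => y /fg.
elim: k f g => [|k IH] f g fg [cf df]; split=> //.
- move=> x Ux; rewrite /prop_for /continuous_at -(fg _ Ux).
  by apply: cvg_trans (cf x Ux); apply: near_eq_cvg; exact: near_fg.
- move=> x Ux; rewrite /prop_for /continuous_at -(fg _ Ux).
  by apply: cvg_trans (cf x Ux); apply: near_eq_cvg; exact: near_fg.
- move=> v; have [dv Cv] := df v; split.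
    by move=> x Ux; apply: near_eq_derivable (dv x Ux); exact: near_fg.
  by apply: IH Cv => x Ux; apply: near_eq_derive; exact: near_fg.
Qed.

Lemma Ck_local k U f :
  (forall x, U x -> exists2 U', U' x & Ck k U' f) -> Ck k U f.
Proof.
elim: k f => [|k IH] f loc; split=> //; try by move=> x /loc[U' U'x [cf _]]; exact: cf.
move=> v; split.
  by move=> x /loc[U' U'x [_ /(_ v)[dv _]]]; exact: dv.
by apply: IH => x /loc[U' U'x [_ /(_ v)[_ Cv]]]; exists U'.
Qed.

Lemma Ck_cst k U (c : W) : Ck k U (fun=> c).
Proof.
elim: k c => [|k IH] c; split=> //; try by move=> x _; exact: cst_continuous.
move=> v; split; first by move=> x _; exact: derivable_cst.
have -> : 'D_v (fun=> c) = (fun=> 0) :> (V -> W); last exact: IH.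
by apply/funext => x; exact: derive_cst.
Qed.

Lemma Ck_linear k U (f : {linear V -> W}) : continuous f -> Ck k U f.
Proof.
move=> cf; have df x := linear_differentiable x cf.
case: k => [|k]; split=> //; try by move=> x _; exact: cf.
move=> v; split; first by move=> x _; apply: diff_derivable.
have -> : 'D_v f = (fun=> f v); last exact: Ck_cst.
by apply/funext => x; rewrite deriveE // diff_lin.
Qed.

Lemma Ck_add k U f g : open U -> Ck k U f -> Ck k U g -> Ck k U (fun x => f x + g x).
Proof.
move=> oU; elim: k f g => [|k IH] f g [cf df] [cg dg]; split=> //;
  try by move=> x Ux; apply: continuousD; [exact: cf | exact: cg].
move=> v; have [dfv Cf] := df v; have [dgv Cg] := dg v; split.
  by move=> x Ux; apply: derivableD; [exact: dfv | exact: dgv].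
apply: Ck_ext (IH _ _ Cf Cg) => // x Ux.
by rewrite deriveD; [|exact: dfv|exact: dgv].
Qed.

Lemma Ck_sum k U (I : Type) (r : seq I) (F : I -> V -> W) : open U ->
  (forall i, Ck k U (F i)) -> Ck k U (fun x => \sum_(i <- r) F i x).
Proof.
move=> oU CF; elim: r => [|i r IH].
  by apply: Ck_ext (Ck_cst k U 0) => // x _; rewrite big_nil.
by apply: Ck_ext (Ck_add oU (CF i) IH) => // x _; rewrite big_cons.
Qed.

End CkGeneral.

Section CkScalar.
Context {R : realType} {V : normedModType R}.
Implicit Types (U : set V) (f g : V -> R).

Lemma Ck_mul k U f g : open U -> Ck k U f -> Ck k U g -> Ck k U (fun x => f x * g x).
Proof.
move=> oU; elim: k f g => [|k IH] f g Cf Cg; have [cf df] := Cf; have [cg dg] := Cg.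
  by split=> // x Ux; apply: continuousM; [exact: cf | exact: cg].
split=> [x Ux|v]; first by apply: continuousM; [exact: cf | exact: cg].
have [dfv Cf'] := df v; have [dgv Cg'] := dg v; split.
  by move=> x Ux; apply: derivableM; [exact: dfv | exact: dgv].
apply: Ck_ext (Ck_add oU (IH _ _ (CkW Cf) Cg') (IH _ _ (CkW Cg) Cf')) => // x Ux.
by rewrite deriveM; [|exact: dfv|exact: dgv].
Qed.

Lemma Ck_inv k U f : open U -> (forall x, U x -> f x != 0) -> Ck k U f ->
  Ck k U (fun x => (f x)^-1).
Proof.
move=> oU f0; elim: k => [|k IH] Cf; have [cf df] := Cf.
  by split=> // x Ux; apply: cvgV; [exact: f0 | exact: cf].
split=> [x Ux|v]; first by apply: cvgV; [exact: f0 | exact: cf].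
have [dfv Cf'] := df v; split.
  by move=> x Ux; apply: derivableV; [exact: f0 | exact: dfv].
have CV := IH (CkW Cf).
apply: Ck_ext (Ck_mul oU (Ck_mul oU CV CV) (Ck_mul oU (Ck_cst k U (-1 : R)) Cf')) => // x Ux.
rewrite (deriveV (f0 _ Ux) (dfv _ Ux)) -[_ *: _]/(_ * _) -exprVn; ring.
Qed.

Lemma Ck_exp k U f n : open U -> Ck k U f -> Ck k U (fun x => f x ^+ n).
Proof.
move=> oU Cf; elim: n => [|n IH]; first exact: Ck_cst.
by apply: Ck_ext (Ck_mul oU Cf IH) => // x _; rewrite exprS.
Qed.

Lemma Ck_prod k U (I : Type) (r : seq I) (F : I -> V -> R) : open U ->
  (forall i, Ck k U (F i)) -> Ck k U (fun x => \prod_(i <- r) F i x).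
Proof.
move=> oU CF; elim: r => [|i r IH].
  by apply: Ck_ext (Ck_cst k U (1 : R)) => // x _; rewrite big_nil.
by apply: Ck_ext (Ck_mul oU (CF i) IH) => // x _; rewrite big_cons.
Qed.

Lemma Ck_mxP k U m n (f : V -> 'M[R]_(m, n)) : open U ->
  Ck k U f <-> (forall i j, Ck k U (fun x => f x i j)).
Proof.
move=> oU; elim: k f => [|k IH] f.
  split=> [[cf _] i j|H]; split=> // x Ux; first exact/continuous_mxE/cf.
  by apply: continuous_mx => i j; have [c _] := H i j; exact: c.
split=> [[cf df] i j|H]; split=> [x Ux|v].
- exact/continuous_mxE/cf.
- have [dv Cv] := df v; have dij x Ux := (derivable_mxP _ _ _).1 (dv x Ux) i j.
  split=> //; apply: Ck_ext ((IH _).1 Cv i j) => // x Ux.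
  by rewrite derive_mx ?mxE //; exact: dv.
- by apply: continuous_mx => i j; have [c _] := H i j; exact: c.
- have dv x : U x -> derivable f x v.
    by move=> Ux; apply/derivable_mxP => i j; have [_ /(_ v)[dv _]] := H i j; exact: dv.
  split=> //; apply/IH => i j; have [_ /(_ v)[_ Cv]] := H i j.
  by apply: Ck_ext Cv => // x Ux; rewrite derive_mx ?mxE //; exact: dv.
Qed.

End CkScalar.

Section CkComp.
Context {R : realType}.

Lemma Ck1_differentiable n (U : set 'rV[R]_n) (f : 'rV[R]_n -> R) x :
  open U -> Ck 1 U f -> U x -> differentiable f x.
Proof.
move=> oU [_ df] Ux; apply: C1_differentiable => i; have [dv [cv _]] := df 'e_i.
  by apply: filterS (open_nbhs_nbhs (conj oU Ux)) => y /dv.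
exact: cv.
Qed.

Lemma Ck1_differentiable_mx n (U : set 'rV[R]_n) p q (f : 'rV[R]_n -> 'M[R]_(p, q)) x :
  open U -> Ck 1 U f -> U x -> differentiable f x.
Proof.
move=> oU Cf Ux; apply: differentiable_mx => i j.
exact: Ck1_differentiable oU ((Ck_mxP _ _ oU).1 Cf i j) Ux.
Qed.

Lemma derive_comp (V V' W : normedModType R) (f : V -> V') (g : V' -> W) x v :
  differentiable f x -> differentiable g (f x) ->
  'D_v (g \o f) x = 'D_('D_v f x) g (f x).
Proof.
move=> df dg; rewrite deriveE; last exact: differentiable_comp.
by rewrite diff_comp // -[LHS]/('d g (f x) ('d f x v)) -(deriveE v df) -(deriveE _ dg).
Qed.

Lemma derive_coord n (W : normedModType R) (g : 'rV[R]_n -> W) x v :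
  differentiable g x -> 'D_v g x = \sum_i v 0 i *: 'D_('e_i) g x.
Proof.
move=> dg; rewrite deriveE // [in LHS](row_sum_delta v) linear_sum.
by apply: eq_bigr => i _; rewrite linearZ /= (deriveE _ dg).
Qed.

(** By the chain rule in coordinates the directional derivatives of a composite
   are sums of products of functions of class [C^k], which makes the induction
   on [k] work. *)
Lemma Ck_comp m n k (O : set 'rV[R]_m) (U : set 'rV[R]_n)
    (f : 'rV[R]_m -> 'rV[R]_n) (g : 'rV[R]_n -> R) :
  open O -> open U -> (forall x, O x -> U (f x)) ->
  Ck k O f -> Ck k U g -> Ck k O (g \o f).
Proof.
move=> oO oU fU; elim: k g => [|k IH] g Cf Cg.
  split=> // x Ox; apply: continuous_comp; first exact: Ck_continuous Cf Ox.
  exact: Ck_continuous Cg (fU _ Ox).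
have df x : O x -> differentiable f x.
  exact: Ck1_differentiable_mx oO (Ck_C1 Cf).
have dg x : O x -> differentiable g (f x).
  by move=> Ox; exact: Ck1_differentiable oU (Ck_C1 Cg) (fU _ Ox).
split=> [x Ox|v].
  apply: continuous_comp; first exact: Ck_continuous Cf Ox.
  exact: Ck_continuous Cg (fU _ Ox).
split; first by move=> x Ox; apply/diff_derivable/differentiable_comp; [exact: df|exact: dg].
apply: (@Ck_ext _ _ _ _ _ (fun x => \sum_i 'D_v f x 0 i * 'D_('e_i) g (f x))) => //.
  by move=> x Ox; rewrite (derive_comp _ (df x Ox) (dg x Ox)) (derive_coord _ (dg x Ox)).
apply: Ck_sum => // i; apply: Ck_mul => //.
  by have [_ /(_ v)[_ Cv]] := Cf; exact: ((Ck_mxP _ _ oO).1 Cv 0 i).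
by have [_ /(_ 'e_i)[_ Cgi]] := Cg; exact: (IH ('D_('e_i) g) (CkW Cf) Cgi).
Qed.

End CkComp.

Section Smooth.
Context {R : realType} {n : nat}.
Implicit Types (O : set 'rV[R]_n).

Lemma smooth_comp m p q O (U : set 'rV[R]_m) (f : 'rV[R]_n -> 'rV[R]_m)
    (g : 'rV[R]_m -> 'M[R]_(p, q)) :
  open O -> open U -> (forall x, O x -> U (f x)) ->
  smooth O f -> smooth U g -> smooth O (g \o f).
Proof.
move=> oO oU fU sf sg k; apply/Ck_mxP => // i j.
exact: (@Ck_comp _ _ _ k O U f (fun y => g y i j)) (sf k) ((Ck_mxP _ _ oU).1 (sg k) i j).
Qed.

Lemma smooth_comp_scalar m O (U : set 'rV[R]_m) (f : 'rV[R]_n -> 'rV[R]_m) (g : 'rV[R]_m -> R) :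
  open O -> open U -> (forall x, O x -> U (f x)) ->
  smooth O f -> smooth U g -> smooth O (g \o f).
Proof. by move=> oO oU fU sf sg k; exact: Ck_comp (sf k) (sg k). Qed.

Lemma smooth_ext (W : normedModType R) O (f g : 'rV[R]_n -> W) :
  open O -> (forall x, O x -> f x = g x) -> smooth O f -> smooth O g.
Proof. by move=> oO fg sf k; exact: Ck_ext (sf k). Qed.

Lemma smooth_sub (W : normedModType R) O Q (f : 'rV[R]_n -> W) :
  Q `<=` O -> smooth O f -> smooth Q f.
Proof. by move=> sO sf k; exact: Ck_sub (sf k). Qed.

Lemma smooth_local (W : normedModType R) O (f : 'rV[R]_n -> W) :
  (forall x, O x -> exists2 Q, Q x & smooth Q f) -> smooth O f.
Proof.
by move=> loc k; apply: Ck_local => x /loc[Q Qx sf]; exists Q.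
Qed.

Lemma smooth_cst (W : normedModType R) O (c : W) : smooth O (fun=> c).
Proof. by move=> k; exact: Ck_cst. Qed.

Lemma smooth_derive (W : normedModType R) O (f : 'rV[R]_n -> W) v :
  smooth O f -> smooth O ('D_v f).
Proof. by move=> sf k; have [_ /(_ v)[]] := sf k.+1. Qed.

Lemma smooth_differentiable O (f : 'rV[R]_n -> R) x :
  open O -> smooth O f -> O x -> differentiable f x.
Proof. by move=> oO sf; exact: Ck1_differentiable (sf 1%N). Qed.

Lemma smooth_differentiable_mx p q O (f : 'rV[R]_n -> 'M[R]_(p, q)) x :
  open O -> smooth O f -> O x -> differentiable f x.
Proof. by move=> oO sf; exact: Ck1_differentiable_mx (sf 1%N). Qed.

Lemma smooth_deriveC O (f : 'rV[R]_n -> R) x v w :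
  open O -> smooth O f -> O x -> 'D_w ('D_v f) x = 'D_v ('D_w f) x.
Proof.
move=> oO sf Ox.
have near_der g u : smooth O g -> \forall y \near x, derivable (g : _ -> R) y u.
  move=> sg; apply: filterS (open_nbhs_nbhs (conj oO Ox)) => y Oy.
  exact/diff_derivable/(smooth_differentiable oO sg).
have cts g : smooth O g -> {for x, continuous (g : _ -> R)}.
  by move=> sg; exact: Ck_continuous (sg 0%N) Ox.
have sv u := smooth_derive u sf.
apply: deriveC.
- exact: near_der.
- exact: near_der.
- exact: near_der (sv v).
- exact: near_der (sv w).
- exact: cts (smooth_derive w (sv v)).
- exact: cts (smooth_derive v (sv w)).
Qed.

End Smooth.

(** * The algebra of wedge products *)

(** Interior multiplication by a constant vector. *)
Definition contr {R : realType} {n : nat} {M : Type} (v : 'rV[R]_n) (w : form R n M) :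
  form R n M := fun x s => w x (v :: s).

Section ShuffleSign.
Variable R : realType.

Lemma shuffle_sign_cons b (m : bitseq) :
  shuffle_sign R (b :: m) = (-1) ^+ (~~ b * count id m) * shuffle_sign R m.
Proof.
rewrite /shuffle_sign -exprD; congr (_ ^+ _).
rewrite big_ord_recl big_ord0 add0n.
under eq_bigr => j _ do rewrite big_ord_recl /=.
rewrite big_split /=; congr (_ + _)%N.
have -> : count id m = (\sum_(i < size m) nth false m i)%N.
  rewrite -sum1_count big_mkcond (big_nth false) big_mkord.
  by apply: eq_bigr => i _; case: nth.
by rewrite big_distrr /=; apply: eq_bigr => j _; case: b; case: nth.
Qed.

End ShuffleSign.

Section WedgeAlgebra.
Context {R : realType} {n : nat} {M : topologicalType}.
Implicit Types (a b c w : form R n M) (x : M) (v : 'rV[R]_n) (s : seq 'rV[R]_n).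

Local Notation par := (parity 1).

Lemma wedge_nil a b x : wedge a b x [::] = a x [::] * b x [::].
Proof.
rewrite /wedge /= (bigD1 [tuple]) //= big1 => [|t /negP[]]; last by apply/eqP; exact: tuple0.
by rewrite /shuffle_sign big_ord0 expr0 mul1r addr0.
Qed.

(** Interior multiplication by a vector is a derivation of the wedge product;
   as it determines a form up to its value on the empty sequence, it reduces
   the algebra of wedge products to inductions on the number of arguments. *)
Lemma contr_wedge v a b :
  contr v (wedge a b) = wedge (contr v a) b + wedge (par a) (contr v b).
Proof.
apply/funext => x; apply/funext => s.
(* A selection of positions in v :: s decides about v, then selects in s. *)
pose cons_t (p : bool * (size s).-tuple bool) := cons_tuple p.1 p.2.
have cons_bij : bijective cons_t.
  exists (fun t => (thead t, behead_tuple t)) => [[e t]|t].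
    by congr pair; apply: val_inj.
  by rewrite [RHS]tuple_eta; apply: val_inj.
rewrite /contr {1}/wedge /= (reindex cons_t) /=; last exact: onW_bij.
rewrite -(pair_bigA _ (fun e (t : (size s).-tuple bool) =>
  shuffle_sign R (cons_t (e, t)) * a x (mask (cons_t (e, t)) (v :: s))
  * b x (mask (map negb (cons_t (e, t))) (v :: s)))) /=.
rewrite big_bool /=; congr (_ + _); apply: eq_bigr => t _.
  by rewrite shuffle_sign_cons mul0n expr0 mul1r.
rewrite shuffle_sign_cons /= mul1n /parity mul1n size_mask ?size_tuple //.
by rewrite -!mulrA mulrCA !mulrA; congr (_ * _ * _); rewrite mulrC.
Qed.

Lemma wedge_cons v a b x s : wedge a b x (v :: s)
  = wedge (contr v a) b x s + wedge (par a) (contr v b) x s.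
Proof. by rewrite -[LHS]/(contr v (wedge a b) x s) contr_wedge. Qed.

Lemma wedge_congr a a' b b' x s : a x =1 a' x -> b x =1 b' x ->
  wedge a b x s = wedge a' b' x s.
Proof. by move=> ea eb; apply: eq_bigr => m _; rewrite ea eb. Qed.

Lemma wedgeDl a a' b : wedge (a + a') b = wedge a b + wedge a' b.
Proof.
apply/funext => x; apply/funext => s; rewrite /wedge -[RHS]/(_ + _) -big_split /=.
by apply: eq_bigr => m _; rewrite -[(a + a') x _]/(_ + _) mulrDr mulrDl.
Qed.

Lemma wedgeDr a b b' : wedge a (b + b') = wedge a b + wedge a b'.
Proof.
apply/funext => x; apply/funext => s; rewrite /wedge -[RHS]/(_ + _) -big_split /=.
by apply: eq_bigr => m _; rewrite -[(b + b') x _]/(_ + _) mulrDr.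
Qed.

Lemma wedgeZl k a b : wedge (k *: a) b = k *: wedge a b.
Proof.
apply/funext => x; apply/funext => s; rewrite /wedge -[RHS]/(k * _) mulr_sumr.
by apply: eq_bigr => m _; rewrite -[(k *: a) x _]/(_ * _) mulrCA !mulrA.
Qed.

Lemma wedgeZr k a b : wedge a (k *: b) = k *: wedge a b.
Proof.
apply/funext => x; apply/funext => s; rewrite /wedge -[RHS]/(k * _) mulr_sumr.
by apply: eq_bigr => m _; rewrite -[(k *: b) x _]/(_ * _) mulrCA !mulrA.
Qed.

Lemma wedge0l b : wedge 0 b = 0.
Proof. by rewrite -[X in wedge X](scale0r b) wedgeZl scale0r. Qed.

Lemma wedge0r a : wedge a 0 = 0.
Proof. by rewrite -[X in wedge _ X](scale0r a) wedgeZr scale0r. Qed.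

Lemma wedgeNl a b : wedge (- a) b = - wedge a b.
Proof. by rewrite -scaleN1r wedgeZl scaleN1r. Qed.

Lemma wedgeNr a b : wedge a (- b) = - wedge a b.
Proof. by rewrite -scaleN1r wedgeZr scaleN1r. Qed.

Lemma wedge_suml (T : Type) (r : seq T) (F : T -> form R n M) b :
  wedge (\sum_(t <- r) F t) b = \sum_(t <- r) wedge (F t) b.
Proof.
elim: r => [|t r IH]; first by rewrite !big_nil wedge0l.
by rewrite !big_cons wedgeDl IH.
Qed.

Lemma wedge_sumr (T : Type) (r : seq T) a (F : T -> form R n M) :
  wedge a (\sum_(t <- r) F t) = \sum_(t <- r) wedge a (F t).
Proof.
elim: r => [|t r IH]; first by rewrite !big_nil wedge0r.
by rewrite !big_cons wedgeDr IH.
Qed.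

Lemma parD a b : par (a + b) = par a + par b.
Proof. by apply/funext => x; apply/funext => s; rewrite /parity -mulrDr. Qed.

Lemma parZ k a : par (k *: a) = k *: par a.
Proof. by apply/funext => x; apply/funext => s; rewrite /parity -[RHS]/(_ * _) mulrCA. Qed.

Lemma parN a : par (- a) = - par a.
Proof. by rewrite -scaleN1r parZ scaleN1r. Qed.

Lemma par0 : par (0 : form R n M) = 0.
Proof. by apply/funext => x; apply/funext => s; rewrite /parity mulr0. Qed.

Lemma parK : involutive (par : form R n M -> form R n M).
Proof.
by move=> a; apply/funext => x; apply/funext => s; rewrite /parity mulrA -expr2 sqrr_sign mul1r.
Qed.

Lemma contr_par v a : contr v (par a) = - par (contr v a).
Proof.
apply/funext => x; apply/funext => s; rewrite -[RHS]/(- (_ * _)) /contr /parity /=.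
by rewrite !mul1n exprS mulN1r mulNr.
Qed.

Lemma contrN v a : contr v (- a) = - contr v a.
Proof. by []. Qed.

Lemma par_wedge a b : par (wedge a b) = wedge (par a) (par b).
Proof.
apply/funext => x; apply/funext => s; elim: s a b => [|v s IH] a b.
  by rewrite /parity !wedge_nil /= muln0 expr0 !mul1r.
rewrite wedge_cons -[LHS]/(contr v (par (wedge a b)) x s) contr_par contr_wedge parD.
rewrite -[LHS]/(- (par (wedge (contr v a) b) x s + par (wedge (par a) (contr v b)) x s)).
by rewrite !IH !contr_par wedgeNl wedgeNr opprD.
Qed.

Lemma wedgeA a b c : wedge a (wedge b c) = wedge (wedge a b) c.
Proof.
apply/funext => x; apply/funext => s; elim: s a b c => [|v s IH] a b c.
  by rewrite !wedge_nil mulrA.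
rewrite !wedge_cons !contr_wedge wedgeDl wedgeDr par_wedge.
by rewrite -[X in _ + X]/(_ + _) -[X in _ = X + _]/(_ + _) !IH addrA.
Qed.

(** Graded commutativity: an even form commutes with every form, and moving
   an odd form across another one costs the parity of the latter. *)
Lemma wedgeC_parity a b :
  (par b = b -> wedge a b = wedge b a) /\ (par b = - b -> wedge a b = wedge b (par a)).
Proof.
suff H s x : forall a b, (par b = b -> wedge a b x s = wedge b a x s) /\
    (par b = - b -> wedge a b x s = wedge b (par a) x s).
  by split=> pb; apply/funext => x; apply/funext => s; have [h1 h2] := H s x a b;
    [exact: h1 | exact: h2].
elim: s => [|v s IH] {}a {}b.
  by rewrite !wedge_nil /parity /= muln0 expr0 mul1r mulrC.
split=> pb; rewrite !wedge_cons pb.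
  have pcb : par (contr v b) = - contr v b.
    by rewrite -[in RHS]pb contr_par opprK.
  have [h1 _] := IH (contr v a) b; have [_ h2] := IH (par a) (contr v b).
  by rewrite h1 // h2 // parK addrC.
have pcb : par (contr v b) = contr v b.
  by rewrite -[RHS]opprK -contrN -pb contr_par opprK.
have [_ h1] := IH (contr v a) b; have [h2 _] := IH (par a) (contr v b).
by rewrite h1 // h2 // contr_par wedgeNl wedgeNr opprK addrC.
Qed.

End WedgeAlgebra.

Section Alternating.
Context {R : realType} {n : nat}.
Implicit Types (l : seq 'rV[R]_n -> R).

Definition multilinear l := forall s1 s2 (k : R) (u v : 'rV[R]_n),
  l (s1 ++ (k *: u + v) :: s2) = k * l (s1 ++ u :: s2) + l (s1 ++ v :: s2).

Definition adjacent_alt l := forall s1 s2 (u : 'rV[R]_n), l (s1 ++ u :: u :: s2) = 0.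

Lemma multilinear_cons l v : multilinear l -> multilinear (fun s => l (v :: s)).
Proof. by move=> ml s1 s2 k p q; exact: (ml (v :: s1)). Qed.

Lemma adjacent_alt_cons l v : adjacent_alt l -> adjacent_alt (fun s => l (v :: s)).
Proof. by move=> al s1 s2 u; exact: (al (v :: s1)). Qed.

Lemma multilinearD l s1 s2 u v : multilinear l ->
  l (s1 ++ (u + v) :: s2) = l (s1 ++ u :: s2) + l (s1 ++ v :: s2).
Proof. by move=> /(_ s1 s2 1 u v); rewrite scale1r mul1r. Qed.

Lemma multilinear0 l s1 s2 : multilinear l -> l (s1 ++ 0 :: s2) = 0.
Proof.
move=> ml; apply/eqP; have := multilinearD s1 s2 0 0 ml.
by rewrite addr0 => /eqP; rewrite addrC -subr_eq subrr eq_sym.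
Qed.

(** Multilinearity turns vanishing on adjacent equal arguments into
   antisymmetry, which brings distant equal arguments together.  The adjacent
   form of alternation is the one that passes through interior products. *)
Lemma alternating_adjacent l : multilinear l -> adjacent_alt l ->
  forall s1 s2 s3 u, l (s1 ++ u :: s2 ++ u :: s3) = 0.
Proof.
move=> ml al s1 s2 s3 u; elim: s2 s1 => [|v s2 IH] s1 //=.
have swap p q t : l (s1 ++ p :: q :: t) = - l (s1 ++ q :: p :: t).
  apply/eqP; rewrite -addr_eq0; apply/eqP; have := al s1 t (p + q).
  rewrite (multilinearD _ _ _ _ ml).
  have h y : l (s1 ++ y :: (p + q) :: t) = l (s1 ++ y :: p :: t) + l (s1 ++ y :: q :: t).
    by have := multilinearD (s1 ++ [:: y]) t p q ml; rewrite -!catA.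
  by rewrite !h !al add0r addr0.
rewrite swap; apply/eqP; rewrite oppr_eq0; apply/eqP.
by have := IH (s1 ++ [:: v]); rewrite -catA.
Qed.

Context {M : topologicalType}.
Implicit Types (a b : form R n M) (x : M).

Lemma multilinear_par a x : multilinear (a x) -> multilinear (parity 1 a x).
Proof.
move=> ml s1 s2 k u v; rewrite /parity ml !size_cat /=; ring.
Qed.

Lemma adjacent_alt_par a x : adjacent_alt (a x) -> adjacent_alt (parity 1 a x).
Proof. by move=> al s1 s2 u; rewrite /parity al mulr0. Qed.

(** An argument in first position is reached by interior multiplication, an
   argument further down by induction. *)
Lemma multilinear_wedge a b x :
  multilinear (a x) -> multilinear (b x) -> multilinear (wedge a b x).
Proof.
move=> ma mb s1 s2 k u v; elim: s1 a b ma mb => [|p s1 IH] a b ma mb.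
  rewrite /= !wedge_cons.
  rewrite (@wedge_congr _ _ _ _ (k *: contr u a + contr v a) b b) //; last first.
    by move=> s; exact: (ma [::] s k u v).
  rewrite (@wedge_congr _ _ _ (parity 1 a) (parity 1 a) (contr (k *: u + v) b)
     (k *: contr u b + contr v b)) //; last by move=> s; exact: (mb [::] s k u v).
  rewrite wedgeDl wedgeDr wedgeZl wedgeZr.
  rewrite -[X in X + _]/(k * _ + _) -[X in _ + X = _]/(k * _ + _); ring.
rewrite /= !wedge_cons (IH _ _ (multilinear_cons p ma) mb).
rewrite (IH _ _ (multilinear_par ma) (multilinear_cons p mb)); ring.
Qed.

(** In first position, the two mixed terms of the double interior product of a
   wedge product cancel, since interior multiplication anticommutes with the
   sign [parity 1]. *)
Lemma adjacent_alt_wedge a b x :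
  adjacent_alt (a x) -> adjacent_alt (b x) -> adjacent_alt (wedge a b x).
Proof.
move=> ma mb s1 s2 u; elim: s1 a b ma mb => [|p s1 IH] a b ma mb /=.
  rewrite !wedge_cons contr_par wedgeNl parK.
  rewrite (@wedge_congr _ _ _ (contr u (contr u a)) 0 b b) //; last by move=> s; exact: (ma [::] s u).
  rewrite (@wedge_congr _ _ _ a a (contr u (contr u b)) 0) //; last by move=> s; exact: (mb [::] s u).
  by rewrite wedge0l wedge0r -[X in _ + (X + _)]/(- _) addr0 add0r subrr.
rewrite wedge_cons (IH _ _ (adjacent_alt_cons p ma) mb).
by rewrite (IH _ _ (adjacent_alt_par ma) (adjacent_alt_cons p mb)) addr0.
Qed.

End Alternating.

Section FunctionWedge.
Context {R : realType} {n : nat} {M : topologicalType}.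
Implicit Types (w : form R n M).

Lemma par_fun (f : M -> R) : parity 1 (form_of_fun f : form R n M) = form_of_fun f.
Proof.
apply/funext => x; apply/funext => -[|v s]; rewrite /parity /=; first by rewrite expr0 mul1r.
by rewrite mulr0.
Qed.

Lemma wedge_fun (f : M -> R) w x s : wedge (form_of_fun f) w x s = f x * w x s.
Proof.
elim: s w => [|v s IH] w; first by rewrite wedge_nil.
rewrite wedge_cons par_fun (_ : contr v (form_of_fun f) = 0) // wedge0l add0r.
by rewrite IH.
Qed.

Definition even_part w : form R n M := 2^-1 *: (w + parity 1 w).
Definition odd_part w : form R n M := 2^-1 *: (w - parity 1 w).

Lemma even_odd w : w = even_part w + odd_part w.
Proof.
apply/funext => x; apply/funext => s.
rewrite -[RHS]/(2^-1 * (w x s + parity 1 w x s) + 2^-1 * (w x s - parity 1 w x s)).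
by field.
Qed.

Lemma par_even w : parity 1 (even_part w) = even_part w.
Proof. by rewrite /even_part parZ parD parK addrC. Qed.

Lemma par_odd w : parity 1 (odd_part w) = - odd_part w.
Proof. by rewrite /odd_part parZ parD parN parK -scalerN opprB addrC. Qed.

(** The sign in the interchange of [b] and [c] depends on their degrees; as the
   forms are inhomogeneous, it is carried by the even and odd parts of [c]. *)
Lemma wedge_interchange a b c e : wedge (wedge a b) (wedge c e)
  = wedge (wedge a (even_part c)) (wedge b e)
    + wedge (wedge a (odd_part c)) (wedge (parity 1 b) e) :> form R n M.
Proof.
rewrite -wedgeA (wedgeA b) [c in LHS]even_odd wedgeDr.
have [he _] := wedgeC_parity b (even_part c).
have [_ ho] := wedgeC_parity b (odd_part c).
rewrite he ?par_even // ho ?par_odd // wedgeDl wedgeDr.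
by rewrite -!wedgeA.
Qed.

End FunctionWedge.

(** * The exterior derivative on Euclidean spaces *)

Section EuclideanForms.
Context {R : realType} {n : nat}.
Local Notation E := 'rV[R]_n.
Implicit Types (a b : form R n E) (u v : E) (s : seq E).

(** The exterior derivative in coordinates: [ext_d A w x] is by conversion
   [eucl_d] of the expression of [w] in the chart of index [x]. *)
Definition eucl_d a : form R n E := fun u s =>
  \sum_(k < size s) (-1) ^+ k * 'D_(s`_k) (a ^~ (omit k s)) u.

Definition derive_form v a : form R n E := fun u s => 'D_v (a ^~ s) u.

Definition derivable_form u a := forall s v, derivable (a ^~ s) u v.

Definition smooth_form (O : set E) a := forall s, smooth O (a ^~ s).

Lemma eucl_d_nil a u : eucl_d a u [::] = 0.
Proof. by rewrite /eucl_d big_ord0. Qed.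

Lemma eucl_d_cons a u v s :
  eucl_d a u (v :: s) = 'D_v (a ^~ s) u - eucl_d (contr v a) u s.
Proof.
rewrite /eucl_d /= big_ord_recl /= expr0 mul1r /omit /= drop0; congr (_ + _).
by rewrite -sumrN; apply: eq_bigr => k _; rewrite exprS mulN1r mulNr.
Qed.

(** Cartan's formula for a constant vector field. *)
Lemma contr_eucl_d v a : contr v (eucl_d a) = derive_form v a - eucl_d (contr v a).
Proof.
by apply/funext => u; apply/funext => s; rewrite /contr eucl_d_cons.
Qed.

Lemma eucl_d_near a b u s :
  (forall s', \forall y \near u, a y s' = b y s') -> eucl_d a u s = eucl_d b u s.
Proof.
move=> ab; apply: eq_bigr => k _; congr (_ * _).
by apply: near_eq_derive; exact: ab.
Qed.

Lemma derivable_formD u a b :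
  derivable_form u a -> derivable_form u b -> derivable_form u (a + b).
Proof. by move=> da db s v; exact: derivableD. Qed.

Lemma derivable_formN u a : derivable_form u a -> derivable_form u (- a).
Proof. by move=> da s v; exact: derivableN. Qed.

Lemma derivable_formZ u k a : derivable_form u a -> derivable_form u (k *: a).
Proof. by move=> da s v; exact: derivableZ. Qed.

Lemma derivable_contr u v a : derivable_form u a -> derivable_form u (contr v a).
Proof. by move=> da s; exact: da. Qed.

Lemma derivable_par u a : derivable_form u a -> derivable_form u (parity 1 a).
Proof. by move=> da s v; apply: (@derivableZ _ _ _ (a ^~ s) ((-1) ^+ (1 * size s))). Qed.

Lemma eucl_dD u a b s : derivable_form u a -> derivable_form u b ->
  eucl_d (a + b) u s = eucl_d a u s + eucl_d b u s.
Proof.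
move=> da db; rewrite /eucl_d -big_split; apply: eq_bigr => k _ /=.
by rewrite -mulrDr -deriveD.
Qed.

Lemma eucl_dZ u k a s : derivable_form u a -> eucl_d (k *: a) u s = k * eucl_d a u s.
Proof.
move=> da; rewrite /eucl_d mulr_sumr; apply: eq_bigr => i _ /=.
by rewrite mulrCA; congr (_ * _); exact: deriveZ.
Qed.

Lemma eucl_dN u a s : derivable_form u a -> eucl_d (- a) u s = - eucl_d a u s.
Proof. by move=> da; rewrite -scaleN1r eucl_dZ // mulN1r. Qed.

Lemma eucl_d0 u s : eucl_d 0 u s = 0.
Proof.
by rewrite /eucl_d big1 // => k _; rewrite (derive_cst (0 : R)) mulr0.
Qed.

Lemma derivable_form0 u : derivable_form u 0.
Proof. by move=> s v; exact: derivable_cst. Qed.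

Lemma derivable_form_sum u (T : eqType) (r : seq T) (F : T -> form R n E) :
  (forall t, t \in r -> derivable_form u (F t)) -> derivable_form u (\sum_(t <- r) F t).
Proof.
elim: r => [|t r IH] dF; first by rewrite big_nil; exact: derivable_form0.
rewrite big_cons; apply: derivable_formD; first by apply: dF; rewrite mem_head.
by apply: IH => t' t'r; apply: dF; rewrite inE t'r orbT.
Qed.

Lemma eucl_d_sum u (T : eqType) (r : seq T) (F : T -> form R n E) s :
  (forall t, t \in r -> derivable_form u (F t)) ->
  eucl_d (\sum_(t <- r) F t) u s = \sum_(t <- r) eucl_d (F t) u s.
Proof.
elim: r => [|t r IH] dF; first by rewrite !big_nil eucl_d0.
have dr t' : t' \in r -> derivable_form u (F t').
  by move=> t'r; apply: dF; rewrite inE t'r orbT.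
rewrite !big_cons -IH // eucl_dD //; first by apply: dF; rewrite mem_head.
exact: derivable_form_sum.
Qed.

Lemma eucl_d_par u a s : derivable_form u a ->
  eucl_d (parity 1 a) u s = - parity 1 (eucl_d a) u s.
Proof.
elim: s a => [|v s IH] a da; first by rewrite eucl_d_nil /parity eucl_d_nil mulr0 oppr0.
rewrite eucl_d_cons contr_par eucl_dN; last exact/derivable_par/derivable_contr.
rewrite IH; last exact: derivable_contr.
have -> : 'D_v ((parity 1 a)^~ s) u = (-1) ^+ (1 * size s) * 'D_v (a ^~ s) u.
  exact: deriveZ.
rewrite /parity /= eucl_d_cons !mul1n exprS; ring.
Qed.

(** The product rule, for a derivative of the coefficients in a constant
   direction. *)
Lemma is_derive_wedge u v a b s : derivable_form u a -> derivable_form u b ->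
  is_derive u v (wedge a b ^~ s) (wedge (derive_form v a) b u s + wedge a (derive_form v b) u s).
Proof.
elim: s a b => [|w s IH] a b da db.
  have -> : wedge a b ^~ [::] = (a ^~ [::]) * (b ^~ [::]).
    by apply/funext => y; rewrite wedge_nil.
  apply: DeriveDef; first exact: derivableM.
  rewrite deriveM // !wedge_nil addrC; congr (_ + _); by rewrite mulrC.
have -> : wedge a b ^~ (w :: s)
    = (wedge (contr w a) b ^~ s) + (wedge (parity 1 a) (contr w b) ^~ s).
  by apply/funext => y; rewrite wedge_cons.
have h1 := IH _ _ (derivable_contr (v:=w) da) db.
have h2 := IH _ _ (derivable_par da) (derivable_contr (v:=w) db).
have h := is_deriveD h1 h2; apply: is_derive_eq.
have e : derive_form v (parity 1 a) u =1 parity 1 (derive_form v a) u.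
  by move=> t; rewrite /derive_form /parity; exact: deriveZ.
rewrite !wedge_cons (@wedge_congr _ _ _ _ _ _ _ u s e (fun _ => erefl)).
by rewrite addrACA.
Qed.

Lemma derivable_wedge u a b :
  derivable_form u a -> derivable_form u b -> derivable_form u (wedge a b).
Proof. by move=> da db s v; have [] := is_derive_wedge v s da db. Qed.

(** Leibniz' rule, by induction on the number of arguments: interior
   multiplication turns both sides into derivatives in a constant direction,
   where the product rule applies, and shorter instances. *)
Lemma eucl_d_wedge u a b s : derivable_form u a -> derivable_form u b ->
  eucl_d (wedge a b) u s
  = wedge (eucl_d a) b u s + wedge (parity 1 a) (eucl_d b) u s.
Proof.
elim: s a b => [|v s IH] a b da db.
  by rewrite eucl_d_nil !wedge_nil /parity !eucl_d_nil mul0r !mulr0 addr0.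
have dca := derivable_contr (v:=v) da; have dcb := derivable_contr (v:=v) db.
have dpa := derivable_par da.
have [_ D] := is_derive_wedge v s da db.
have d1 := derivable_wedge dca db; have d2 := derivable_wedge dpa dcb.
rewrite eucl_d_cons D contr_wedge (eucl_dD _ d1 d2) (IH _ _ dca db) (IH _ _ dpa dcb).
rewrite !wedge_cons contr_par parK !contr_eucl_d.
rewrite (@wedge_congr _ _ _ (eucl_d (parity 1 a)) (- parity 1 (eucl_d a)) (contr v b) (contr v b) u s) //;
  last by move=> t; exact: eucl_d_par.
rewrite !(wedgeDl, wedgeDr, wedgeNl, wedgeNr).
rewrite -![(_ + _) u s]/(_ + _) -![(- _) u s]/(- _); ring.
Qed.

Lemma smooth_derivable_form O a u : open O -> smooth_form O a -> O u -> derivable_form u a.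
Proof.
move=> oO sa Ou s v; apply: diff_derivable.
exact: smooth_differentiable oO (sa s) Ou.
Qed.

Lemma smooth_formD O a b : open O -> smooth_form O a -> smooth_form O b -> smooth_form O (a + b).
Proof. by move=> oO sa sb s k; exact: (Ck_add oO (sa s k) (sb s k)). Qed.

Lemma smooth_formN O a : open O -> smooth_form O a -> smooth_form O (- a).
Proof.
move=> oO sa s k.
apply: (Ck_ext oO _ (Ck_mul oO (Ck_cst k O (-1 : R)) (sa s k))) => u _.
by rewrite mulN1r.
Qed.

Lemma smooth_contr O v a : smooth_form O a -> smooth_form O (contr v a).
Proof. by move=> sa s; exact: sa. Qed.

Lemma smooth_wedge O a b : open O -> smooth_form O a -> smooth_form O b -> smooth_form O (wedge a b).
Proof.
move=> oO sa sb s k; apply: Ck_sum => // m.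
apply: Ck_mul => //; last exact: sb.
by apply: Ck_mul => //; [exact: Ck_cst | exact: sa].
Qed.

Lemma smooth_eucl_d O a : open O -> smooth_form O a -> smooth_form O (eucl_d a).
Proof.
move=> oO sa s k; apply: Ck_sum => // i; apply: Ck_mul => //; first exact: Ck_cst.
by apply: smooth_derive; exact: sa.
Qed.

Lemma smooth_derive_form O v a : smooth_form O a -> smooth_form O (derive_form v a).
Proof. by move=> sa s; apply: smooth_derive; exact: sa. Qed.

(** By Cartan's formula, [d d] commutes with interior multiplication up to the
   commutator of [d] and a directional derivative, which vanishes because
   directional derivatives commute. *)
Lemma eucl_d_d O a u s : open O -> smooth_form O a -> O u -> eucl_d (eucl_d a) u s = 0.
Proof.
move=> oO sa Ou; elim: s a sa => [|v s IH] a sa; first exact: eucl_d_nil.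
have sda := smooth_eucl_d oO sa.
have sdc := smooth_eucl_d oO (smooth_contr v sa).
have dn b : smooth_form O b -> derivable_form u b.
  by move=> sb; exact: smooth_derivable_form sb Ou.
rewrite eucl_d_cons contr_eucl_d eucl_dD; last 2 first.
- exact/dn/smooth_derive_form.
- exact/derivable_formN/dn.
rewrite eucl_dN; last exact: dn.
rewrite IH ?oppr0 ?addr0; last exact: smooth_contr.
apply/eqP; rewrite subr_eq0; apply/eqP.
have -> : eucl_d a ^~ s = \sum_(k < size s) ((-1) ^+ k *: 'D_(s`_k) (a ^~ (omit k s))).
  by apply/funext => y; rewrite fct_sumE.
rewrite derive_sum => [|k]; last first.
  exact/derivableZ/(dn _ (smooth_derive_form _ sa)).
apply: eq_bigr => k _; rewrite deriveZ; last exact: (dn _ (smooth_derive_form _ sa)).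
have e := smooth_deriveC s`_k v oO (sa (omit k s)) Ou.
exact: (congr1 (fun z => (-1) ^+ k * z) e).
Qed.

(** In first position the derivative in a constant direction has to be linear in
   the direction, hence the differentiability in the sense of Fréchet. *)
Lemma multilinear_eucl_d a u : (\forall y \near u, multilinear (a y)) ->
  (forall s, differentiable (a ^~ s) u) -> multilinear (eucl_d a u).
Proof.
move=> ml da s1 s2 k p q.
have dn b : (forall s, differentiable (b ^~ s) u) -> derivable_form u b.
  by move=> db s v; exact: diff_derivable.
elim: s1 a ml da => [|w s1 IH] a ml da /=; rewrite !eucl_d_cons.
  rewrite (@eucl_d_near (contr (k *: p + q) a) (k *: contr p a + contr q a)); last first.
    by move=> t; apply: filterS ml => y my; exact: (my [::]).
  have dc v : derivable_form u (contr v a) by exact/derivable_contr/dn.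
  rewrite eucl_dD //; last exact: derivable_formZ.
  rewrite eucl_dZ // !deriveE // linearP -[X in X + _ - _]/(k * _); ring.
rewrite (IH (contr w a)); last 2 first.
- by apply: filterS ml => y my; exact: multilinear_cons.
- by move=> s; exact: da.
have -> : 'D_w (a ^~ (s1 ++ (k *: p + q) :: s2)) u =
   'D_w (k *: (a ^~ (s1 ++ p :: s2)) + (a ^~ (s1 ++ q :: s2))) u.
  by apply: near_eq_derive; apply: filterS ml => y; exact.
rewrite deriveD; [|exact/derivableZ/dn|exact: dn].
rewrite deriveZ; last exact: dn.
rewrite -[X in X + _ - _]/(k * _); ring.
Qed.

(** In first position, the two derivatives in the direction of the repeated
   argument cancel. *)
Lemma adjacent_alt_eucl_d a u : (\forall y \near u, adjacent_alt (a y)) ->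
  adjacent_alt (eucl_d a u).
Proof.
move=> al s1 s2 p; elim: s1 a al => [|w s1 IH] a al /=; rewrite !eucl_d_cons.
  rewrite opprB addrC subrK (@eucl_d_near _ 0) ?eucl_d0 // => t.
  by apply: filterS al => y ay; exact: (ay [::]).
rewrite (IH (contr w a)); last by apply: filterS al => y; exact: adjacent_alt_cons.
rewrite (@near_eq_derive _ _ _ _ (cst 0)) ?derive_cst ?subr0 //.
by apply: filterS al => y; exact.
Qed.

End EuclideanForms.

(** * Charts, smooth maps and pullbacks *)

Lemma open_preimage_on (S T : topologicalType) (D : set S) (f : S -> T) (W : set T) :
  open D -> (forall x, D x -> {for x, continuous f}) -> open W -> open (D `&` f @^-1` W).
Proof.
move=> oD cf oW; rewrite openE => x [Dx Wfx].
apply: filterI; first exact: open_nbhs_nbhs.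
by apply: (cf x Dx); exact: open_nbhs_nbhs.
Qed.

Lemma smooth_row_mx (R : realType) n p q (O : set 'rV[R]_n)
    (f : 'rV[R]_n -> 'rV[R]_p) (g : 'rV[R]_n -> 'rV[R]_q) :
  open O -> smooth O f -> smooth O g -> smooth O (fun u => row_mx (f u) (g u)).
Proof.
move=> oO sf sg k; apply/Ck_mxP => // i j; case: (splitP j) => l jl.
  apply: (Ck_ext oO _ ((Ck_mxP _ _ oO).1 (sf k) i l)) => u _.
  by rewrite -(row_mxEl (f u) (g u)); congr (row_mx _ _ _ _); exact: val_inj.
apply: (Ck_ext oO _ ((Ck_mxP _ _ oO).1 (sg k) i l)) => u _.
by rewrite -(row_mxEr (f u) (g u)); congr (row_mx _ _ _ _); exact: val_inj.
Qed.

Lemma continuous_row_mx (R : realType) p q (T : topologicalType)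
    (f : T -> 'rV[R]_p) (g : T -> 'rV[R]_q) x :
  {for x, continuous f} -> {for x, continuous g} ->
  {for x, continuous (fun u => row_mx (f u) (g u))}.
Proof.
move=> cf cg; apply: continuous_mx => i j; case: (splitP j) => l jl.
  have -> : (fun y => row_mx (f y) (g y) i j) = (fun y => f y i l).
    apply/funext => u.
    by rewrite -(row_mxEl (f u) (g u)); congr (row_mx _ _ _ _); exact: val_inj.
  exact: continuous_mxE.
have -> : (fun y => row_mx (f y) (g y) i j) = (fun y => g y i l).
  apply/funext => u.
  by rewrite -(row_mxEr (f u) (g u)); congr (row_mx _ _ _ _); exact: val_inj.
exact: continuous_mxE.
Qed.

Lemma smooth_lsubmx (R : realType) p q (O : set 'rV[R]_(p + q)) :
  smooth O (lsubmx : 'rV[R]_(p + q) -> 'rV[R]_p).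
Proof. by move=> k; apply: (@Ck_linear _ _ _ k O lsubmx); exact: continuous_lsubmx. Qed.

Lemma smooth_rsubmx (R : realType) p q (O : set 'rV[R]_(p + q)) :
  smooth O (rsubmx : 'rV[R]_(p + q) -> 'rV[R]_q).
Proof. by move=> k; apply: (@Ck_linear _ _ _ k O rsubmx); exact: continuous_rsubmx. Qed.

Lemma hausdorff_prod (S T : topologicalType) :
  hausdorff_space S -> hausdorff_space T -> hausdorff_space (S * T)%type.
Proof.
move=> hS hT [x1 y1] [x2 y2] cl; congr pair.
  apply: hS => A B nA nB.
  have [||[x y] [/= Ax Bx]] := cl (fst @^-1` A) (fst @^-1` B); last by exists x.
    exact: (@cvg_fst _ _ (nbhs x1) (nbhs y1)).
  exact: (@cvg_fst _ _ (nbhs x2) (nbhs y2)).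
apply: hT => A B nA nB.
have [||[x y] [/= Ax Bx]] := cl (snd @^-1` A) (snd @^-1` B); last by exists y.
  exact: (@cvg_snd _ _ (nbhs x1) (nbhs y1)).
exact: (@cvg_snd _ _ (nbhs x2) (nbhs y2)).
Qed.

(** Euclidean spaces are manifolds, so that parametrizations are smooth maps and
   expressions in charts are pullbacks. *)
Definition eucl_atlas (R : realType) n : atlas R n 'rV[R]_n :=
  {| dom := fun=> setT; chart := fun=> id; chartV := fun=> id |}.

Lemma smooth_id (R : realType) n (O : set 'rV[R]_n) : smooth O (id : 'rV[R]_n -> 'rV[R]_n).
Proof. by move=> k; apply: (@Ck_linear _ _ _ k O idfun) => x; exact: cvg_id. Qed.

Lemma eucl_manifold (R : realType) n : is_manifold (eucl_atlas R n).
Proof.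
split => /=.
- exact: (@norm_hausdorff R 'rV[R]_n).
- by move=> x; exact: openT.
- by [].
- by move=> x; rewrite image_id; exact: openT.
- by move=> x y _; exact: cvg_id.
- by move=> x y _; exact: cvg_id.
- by [].
- by move=> x y; exact: smooth_id.
Qed.

Section OneManifold.
Context {R : realType} {n : nat} {M : topologicalType} {A : atlas R n M}.
Hypothesis hA : is_manifold A.
Implicit Types (x p : M) (u : 'rV[R]_n) (W : set M).

Lemma chart_imgE W x :
  chart A x @` (W `&` dom A x) = (chart A x @` dom A x) `&` chartV A x @^-1` W.
Proof.
apply/seteqP; split=> [u [y [Wy Dy] <-]|u [[y Dy <-] Wy]].
  by split; [exists y | rewrite /preimage /= (chartK hA)].
by exists y => //; split => //; rewrite /preimage /= (chartK hA) // in Wy.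
Qed.

Lemma chart_img_open W x : open W -> open (chart A x @` (W `&` dom A x)).
Proof.
move=> oW; rewrite chart_imgE; apply: open_preimage_on => //; first exact: img_open.
by move=> u; exact: chartV_cont.
Qed.

Lemma chartVK x u : (chart A x @` dom A x) u -> chart A x (chartV A x u) = u.
Proof. by case=> y Dy <-; rewrite (chartK hA). Qed.

Lemma chartK_self x : chartV A x (chart A x x) = x.
Proof. by rewrite (chartK hA) //; exact: dom_self. Qed.

Lemma chart_self x : (chart A x @` dom A x) (chart A x x).
Proof. by exists x => //; exact: dom_self. Qed.

Lemma near_chartV W p : open W -> W p ->
  \forall u \near chart A p p, W (chartV A p u) /\ (chart A p @` dom A p) u.
Proof.
move=> oW Wp; have oi := chart_img_open (x := p) oW.
have Wi : (chart A p @` (W `&` dom A p)) (chart A p p).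
  by exists p => //; split => //; exact: dom_self.
apply: filterS (open_nbhs_nbhs (conj oi Wi)) => u.
by rewrite chart_imgE => -[].
Qed.

End OneManifold.

Section SmoothMaps.
Context {R : realType} {m n : nat} {M N : topologicalType}.
Context {A : atlas R m M} {B : atlas R n N}.
Hypotheses (hA : is_manifold A) (hB : is_manifold B).
Implicit Types (f h : M -> N) (U : set M) (p x : M).

Lemma smooth_map_sub U U' f : U' `<=` U -> smooth_map A B U f -> smooth_map A B U' f.
Proof.
move=> sU [cf sf]; split=> [x /sU|x y]; first exact: cf.
by apply: smooth_sub (sf x y) => u [z [[/sU Uz Dz] Fz] <-]; exists z.
Qed.

Lemma smooth_map_open U f y : open U -> smooth_map A B U f ->
  open (U `&` f @^-1` dom B y).
Proof. by move=> oU [cf _]; apply: open_preimage_on => //; exact: dom_open. Qed.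

Lemma smooth_map_chart_open U f x y : open U -> smooth_map A B U f ->
  open (chart A x @` (U `&` dom A x `&` f @^-1` dom B y)).
Proof.
by move=> oU sf; rewrite setIAC; apply: chart_img_open => //; exact: smooth_map_open.
Qed.

Lemma smooth_map_ext U f h : open U -> (forall x, U x -> f x = h x) ->
  smooth_map A B U f -> smooth_map A B U h.
Proof.
move=> oU fh sf; have [cf sff] := sf; split=> [x Ux|x y].
  rewrite /prop_for /continuous_at -(fh _ Ux).
  apply: cvg_trans (cf x Ux); apply: near_eq_cvg.
  by apply: filterS (open_nbhs_nbhs (conj oU Ux)) => z /fh.
have -> : U `&` dom A x `&` h @^-1` dom B y = U `&` dom A x `&` f @^-1` dom B y.
  by apply/seteqP; split=> z [[Uz Dz]]; rewrite /preimage /= (fh _ Uz).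
apply: smooth_ext (sff x y); first exact: smooth_map_chart_open.
by move=> _ [z [[Uz Dz] _] <-] /=; rewrite (chartK hA) // (fh _ Uz).
Qed.

Lemma smooth_map_cst U c : smooth_map A B U (fun=> c).
Proof. by split=> [x _|x y]; [exact: cst_continuous | exact: smooth_cst]. Qed.

Lemma smooth_map_differentiable U f p : open U -> smooth_map A B U f -> U p ->
  differentiable (chart B (f p) \o f \o chartV A p) (chart A p p).
Proof.
move=> oU sf Up; have [_ sff] := sf.
apply: smooth_differentiable_mx (smooth_map_chart_open (x := p) (y := f p) oU sf) (sff p (f p)) _.
by exists p => //; split; [split=> //; exact: dom_self | exact: dom_self].
Qed.

Lemma tangent_mapP U f p k u v : open U -> smooth_map A B U f -> U p ->
  tangent_map A B f p (k *: u + v) = k *: tangent_map A B f p u + tangent_map A B f p v.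
Proof.
move=> oU sf Up; have df := smooth_map_differentiable oU sf Up.
by rewrite /tangent_map !deriveE // linearP.
Qed.

Lemma multilinear_pullback U f p (w : form R n N) : open U -> smooth_map A B U f -> U p ->
  multilinear (w (f p)) -> multilinear (pullback A B f w p).
Proof.
move=> oU sf Up ml s1 s2 k u v.
by rewrite /pullback !map_cat /= (tangent_mapP _ _ _ oU sf Up) ml.
Qed.

Lemma adjacent_alt_pullback f p (w : form R n N) :
  adjacent_alt (w (f p)) -> adjacent_alt (pullback A B f w p).
Proof. by move=> al s1 s2 u; rewrite /pullback map_cat /= al. Qed.

(** Tangent maps only depend on the germ of the map. *)
Lemma pullback_ext W f h p (w : form R n N) : open W -> W p ->
  (forall x, W x -> f x = h x) -> pullback A B f w p = pullback A B h w p.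
Proof.
move=> oW Wp fh; apply/funext => s; rewrite /pullback (fh _ Wp); congr (w _ _).
apply: eq_map => v; rewrite /tangent_map (fh _ Wp); apply: near_eq_derive.
by apply: filterS (near_chartV hA oW Wp) => u [Wu _]; rewrite /= (fh _ Wu).
Qed.

Lemma pullbackD f (a b : form R n N) :
  pullback A B f (a + b) = pullback A B f a + pullback A B f b.
Proof. by []. Qed.

Lemma pullback_sum (T : Type) (r : seq T) f (F : T -> form R n N) :
  pullback A B f (\sum_(t <- r) F t) = \sum_(t <- r) pullback A B f (F t).
Proof.
elim: r => [|t r IH]; first by rewrite !big_nil.
by rewrite !big_cons pullbackD IH.
Qed.

Lemma pullback_parity f (a : form R n N) :
  pullback A B f (parity 1 a) = parity 1 (pullback A B f a).
Proof. by apply/funext => x; apply/funext => s; rewrite /pullback /parity size_map. Qed.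

(** Wedge products only involve the values at one point, where a pullback is a
   substitution in the arguments. *)
Lemma wedge_map (T : 'rV[R]_m -> 'rV[R]_n) (a b : form R n N) (y : N) (a' b' : form R m M) x s :
  (forall s, a' x s = a y (map T s)) -> (forall s, b' x s = b y (map T s)) ->
  wedge a' b' x s = wedge a b y (map T s).
Proof.
elim: s a b a' b' => [|v s IH] a b a' b' ha hb /=; first by rewrite !wedge_nil ha hb.
rewrite !wedge_cons; congr (_ + _); apply: IH => // t; first exact: (ha (v :: t)).
  by rewrite /parity ha size_map.
exact: (hb (v :: t)).
Qed.

Lemma pullback_wedge f (a b : form R n N) :
  pullback A B f (wedge a b) = wedge (pullback A B f a) (pullback A B f b).
Proof. by apply/funext => x; apply/funext => s; apply/esym/wedge_map. Qed.

End SmoothMaps.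

(** * Composition, charts and products *)

Section Composition.
Context {R : realType} {m n l : nat} {M N L : topologicalType}.
Context {A : atlas R m M} {B : atlas R n N} {C : atlas R l L}.
Hypotheses (hA : is_manifold A) (hB : is_manifold B) (hC : is_manifold C).
Context {U : set M} {V : set N} {f : M -> N} {h : N -> L}.
Hypotheses (oU : open U) (oV : open V) (fUV : forall x, U x -> V (f x)).
Hypotheses (sf : smooth_map A B U f) (sh : smooth_map B C V h).

(** Smoothness is local, and around [p] the expression of [h \o f] in charts is
   the composite of the expressions of [f] and [h], through the chart of index
   [f p]. *)
Lemma smooth_map_comp : smooth_map A C U (h \o f).
Proof.
have [cf sff] := sf; have [ch shh] := sh.
split=> [x Ux|x z].
  by apply: continuous_comp; [exact: cf | exact/ch/fUV].
apply: smooth_local => _ [p [[Up Dp] Wp] <-].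
pose y := f p; pose T := V `&` h @^-1` dom C z `&` dom B y.
have oT : open T by apply: openI; [exact: smooth_map_open | exact: dom_open].
pose S := U `&` f @^-1` T.
have oS : open S by exact: open_preimage_on.
exists (chart A x @` (S `&` dom A x)).
  by exists p => //; do !split=> //; [exact: fUV | exact: dom_self].
have oO := chart_img_open hA (x := x) oS.
have oQ := smooth_map_chart_open hB hC (x := y) (y := z) oV sh.
apply: (@smooth_ext _ _ _ _ ((chart C z \o h \o chartV B y) \o (chart B y \o f \o chartV A x))) => //.
  move=> _ [q [[Uq [[Vq Wq] Dq]] Dxq] <-] /=.
  by rewrite (chartK hA) // (chartK hB).
apply: smooth_comp oO oQ _ _ (shh y z).
  move=> _ [q [[Uq [[Vq Wq] Dq]] Dxq] <-] /=.
  by exists (f q); last rewrite (chartK hA).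
apply: smooth_sub (sff x y) => _ [q [[Uq [[Vq Wq] Dq]] Dxq] <-].
by exists q.
Qed.

(** The chain rule, again through the chart of index [f p]. *)
Lemma tangent_map_comp p v : U p ->
  tangent_map A C (h \o f) p v = tangent_map B C h (f p) (tangent_map A B f p v).
Proof.
move=> Up; rewrite /tangent_map.
pose F := chart B (f p) \o f \o chartV A p.
pose H := chart C (h (f p)) \o h \o chartV B (f p).
have Fp : F (chart A p p) = chart B (f p) (f p) by rewrite /F /= (chartK_self hA).
have dF : differentiable F (chart A p p) by exact: smooth_map_differentiable oU sf Up.
have dH : differentiable H (F (chart A p p)).
  by rewrite Fp; exact: smooth_map_differentiable oV sh (fUV Up).
rewrite -/F -/H -Fp -(derive_comp v dF dH); apply: near_eq_derive.
have oW := smooth_map_open hB (f p) oU sf.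
have Wp : (U `&` f @^-1` dom B (f p)) p by split => //; exact: dom_self.
apply: filterS (near_chartV hA oW Wp) => u [[_ Df] _].
by rewrite /H /F /= (chartK hB).
Qed.

Lemma pullback_comp w p : U p ->
  pullback A C (h \o f) w p = pullback A B f (pullback B C h w) p.
Proof.
move=> Up; apply/funext => s; rewrite /pullback -map_comp; congr (w _ _).
by apply: eq_map => v; exact: tangent_map_comp.
Qed.

End Composition.

Section Charts.
Context {R : realType} {m n : nat} {M N : topologicalType}.
Context {A : atlas R m M} {B : atlas R n N}.
Hypotheses (hA : is_manifold A) (hB : is_manifold B).

Lemma smooth_map_id (U : set M) : smooth_map A A U id.
Proof.
split=> [x _|x y]; first exact: cvg_id.
by apply: smooth_sub (chart_smooth hA x y) => _ [z [[_ Dz] Wz] <-]; exists z.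
Qed.

Lemma smooth_chartV x :
  smooth_map (eucl_atlas R m) A (chart A x @` dom A x) (chartV A x).
Proof.
split=> [u|u y]; first exact: chartV_cont.
apply: smooth_sub (chart_smooth hA x y) => _ [z [[[q Dq <-] _] Wz] <-] /=.
by exists q => //; split => //; move: Wz; rewrite /preimage /= (chartK hA).
Qed.

Lemma chart_open x : open (chart A x @` dom A x).
Proof. exact: img_open. Qed.

Lemma in_chartE (w : form R m M) x : in_chart A w x = pullback (eucl_atlas R m) A (chartV A x) w.
Proof. by []. Qed.

Lemma tangent_map_self p v :
  'D_v (chart A (chartV A p (chart A p p)) \o chartV A p) (chart A p p) = v.
Proof.
rewrite (chartK_self hA) (@near_eq_derive _ _ _ _ id) ?derive_id //.
have := near_chartV hA openT (I : setT p).
by apply: filterS => u [_ iu] /=; rewrite (chartVK hA).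
Qed.

(** The change of coordinates from the chart of index [p] to itself is the
   identity near the image of [p]. *)
Lemma in_chart_self (w : form R m M) p s : in_chart A w p (chart A p p) s = w p s.
Proof.
rewrite /in_chart; have -> : [seq 'D_v (chart A (chartV A p (chart A p p)) \o chartV A p)
     (chart A p p) | v <- s] = s.
  by rewrite -[RHS]map_id; apply: eq_map => v; exact: tangent_map_self.
by rewrite (chartK_self hA).
Qed.

(** A pullback at [p] is the pullback by the expression of the map in the
   chart around [p]. *)
Lemma pullback_chart (f : M -> N) (w : form R n N) p s :
  pullback A B f w p s
  = pullback (eucl_atlas R m) B (f \o chartV A p) w (chart A p p) s.
Proof.
rewrite /pullback /= (chartK_self hA); congr (w _ _); apply: eq_map => v.
by rewrite /tangent_map /= (chartK_self hA).
Qed.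

Lemma ext_d_chart (w : form R m M) p s :
  ext_d A w p s = eucl_d (pullback (eucl_atlas R m) A (chartV A p) w) (chart A p p) s.
Proof. by []. Qed.

Lemma ext_d_near (a b : form R m M) (W : set M) p s : open W -> W p ->
  (forall x, W x -> a x = b x) -> ext_d A a p s = ext_d A b p s.
Proof.
move=> oW Wp ab; rewrite !ext_d_chart; apply: eucl_d_near => t.
by apply: filterS (near_chartV hA oW Wp) => u [Wu _]; rewrite /pullback ab.
Qed.

Lemma smooth_fun_comp (U : set N) (V : set M) (f : N -> R) (F : M -> N) :
  open U -> open V -> (forall x, V x -> U (F x)) ->
  smooth_fun B U f -> smooth_map A B V F -> smooth_fun A V (f \o F).
Proof.
move=> oU oV VU sf sF x; apply: smooth_local => _ [p [Vp Dp] <-].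
have [cF sFF] := sF; pose y := F p.
exists (chart A x @` (V `&` dom A x `&` F @^-1` dom B y)).
  by exists p => //; split => //; exact: dom_self.
have oO := smooth_map_chart_open hA hB (x := x) (y := y) oV sF.
have oQ := chart_img_open hB (x := y) oU.
apply: (@smooth_ext _ _ _ _ ((f \o chartV B y) \o (chart B y \o F \o chartV A x))) => //.
  by move=> _ [q [[Vq Dq] Wq] <-] /=; rewrite (chartK hA) // (chartK hB).
apply: smooth_comp_scalar oO oQ _ (sFF x y) (sf y).
move=> _ [q [[Vq Dq] Wq] <-] /=; rewrite (chartK hA) //.
by exists (F q) => //; split => //; exact: VU.
Qed.

End Charts.

Arguments chart_open {R m M A} hA x.

Section Products.
Context {R : realType} {m n l : nat} {M N L : topologicalType}.
Context {A : atlas R m M} {B : atlas R n N} {C : atlas R l L}.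
Hypotheses (hA : is_manifold A) (hB : is_manifold B) (hC : is_manifold C).

Lemma prod_chart_img p : chart (prod_atlas A B) p @` dom (prod_atlas A B) p
  = lsubmx @^-1` (chart A p.1 @` dom A p.1) `&` rsubmx @^-1` (chart B p.2 @` dom B p.2).
Proof.
apply/seteqP; split=> [_ [q [D1 D2] <-]|u [[x Dx xE] [y Dy yE]]] /=.
  by rewrite /preimage /= row_mxKl row_mxKr; split; [exists q.1 | exists q.2].
by exists (x, y) => //=; rewrite xE yE hsubmxK.
Qed.

Lemma prod_manifold : is_manifold (prod_atlas A B).
Proof.
have oimg p : open (chart (prod_atlas A B) p @` dom (prod_atlas A B) p).
  rewrite prod_chart_img; apply: openI; apply: open_comp => [u _|].
  - exact: continuous_lsubmx.
  - exact: img_open.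
  - exact: continuous_rsubmx.
  - exact: img_open.
have cfst (z : M * N) : {for z, continuous fst} by exact: cvg_fst.
have csnd (z : M * N) : {for z, continuous snd} by exact: cvg_snd.
split=> //.
- exact: hausdorff_prod (manifold_hausdorff hA) (manifold_hausdorff hB).
- move=> p; rewrite -[dom _ p]/(fst @^-1` dom A p.1 `&` snd @^-1` dom B p.2).
  by apply: openI; apply: open_comp => [z _|]; [exact: cfst|exact: dom_open|exact: csnd|exact: dom_open].
- by move=> p; split; exact: dom_self.
- move=> p q [D1 D2]; apply: continuous_row_mx.
    by apply: (continuous_comp (cfst q)); exact: chart_cont.
  by apply: (continuous_comp (csnd q)); exact: chart_cont.
- move=> p u; rewrite prod_chart_img => -[D1 D2].
  have h1 : {for u, continuous (chartV A p.1 \o (lsubmx : 'rV[R]_(m + n) -> 'rV[R]_m))}.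
    by apply: continuous_comp; [exact: continuous_lsubmx | exact: chartV_cont].
  have h2 : {for u, continuous (chartV B p.2 \o (rsubmx : 'rV[R]_(m + n) -> 'rV[R]_n))}.
    by apply: continuous_comp; [exact: continuous_rsubmx | exact: chartV_cont].
  exact: cvg_pair h1 h2.
- by move=> p [q1 q2] [D1 D2]; rewrite /= row_mxKl row_mxKr (chartK hA) // (chartK hB).
- move=> p q.
  set O := _ @` _.
  have OE : O = (lsubmx @^-1` (chart A p.1 @` (dom A p.1 `&` dom A q.1)))
       `&` (rsubmx @^-1` (chart B p.2 @` (dom B p.2 `&` dom B q.2))).
    apply/seteqP; split=> [_ [z [[D1 D2] [E1 E2]] <-]|u [[x [D1 E1] xE] [y [D2 E2] yE]]] /=.
      by rewrite /preimage /= row_mxKl row_mxKr; split; [exists z.1 | exists z.2].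
    by exists (x, y) => //=; rewrite xE yE hsubmxK.
  have o1 : open (chart A p.1 @` (dom A p.1 `&` dom A q.1)).
    by rewrite setIC; apply: chart_img_open => //; exact: dom_open.
  have o2 : open (chart B p.2 @` (dom B p.2 `&` dom B q.2)).
    by rewrite setIC; apply: chart_img_open => //; exact: dom_open.
  have oO : open O.
    by rewrite OE; apply: openI; apply: open_comp => // u _;
      [exact: continuous_lsubmx | exact: continuous_rsubmx].
  apply: smooth_row_mx => //.
    apply: (@smooth_comp _ _ _ _ _ O _ lsubmx (chart A q.1 \o chartV A p.1) oO o1).
    - by rewrite OE => u [].
    - exact: smooth_lsubmx.
    - exact: chart_smooth.
  apply: (@smooth_comp _ _ _ _ _ O _ rsubmx (chart B q.2 \o chartV B p.2) oO o2).
  - by rewrite OE => u [].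
  - exact: smooth_rsubmx.
  - exact: chart_smooth.
Qed.

Lemma smooth_map_fst (U : set (M * N)) : smooth_map (prod_atlas A B) A U fst.
Proof.
apply: (@smooth_map_sub _ _ _ _ _ _ _ setT) => //; split=> [z _|p y]; first exact: cvg_fst.
rewrite setTI setIC.
set O := _ @` _.
have oO : open O.
  apply: (chart_img_open prod_manifold); apply: open_comp; last exact: dom_open.
  by move=> z _; exact: cvg_fst.
have o1 : open (chart A p.1 @` (dom A y `&` dom A p.1)).
  by apply: chart_img_open => //; exact: dom_open.
apply: (@smooth_comp _ _ _ _ _ O _ lsubmx (chart A y \o chartV A p.1) oO o1).
- by move=> _ [q [Dq [D1 D2]] <-] /=; rewrite row_mxKl; exists q.1.
- exact: smooth_lsubmx.
- by rewrite setIC; exact: chart_smooth.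
Qed.

Lemma smooth_map_snd (U : set (M * N)) : smooth_map (prod_atlas A B) B U snd.
Proof.
apply: (@smooth_map_sub _ _ _ _ _ _ _ setT) => //; split=> [z _|p y]; first exact: cvg_snd.
rewrite setTI setIC.
set O := _ @` _.
have oO : open O.
  apply: (chart_img_open prod_manifold); apply: open_comp; last exact: dom_open.
  by move=> z _; exact: cvg_snd.
have o1 : open (chart B p.2 @` (dom B y `&` dom B p.2)).
  by apply: chart_img_open => //; exact: dom_open.
apply: (@smooth_comp _ _ _ _ _ O _ rsubmx (chart B y \o chartV B p.2) oO o1).
- by move=> _ [q [Dq [D1 D2]] <-] /=; rewrite row_mxKr; exists q.2.
- exact: smooth_rsubmx.
- by rewrite setIC; exact: chart_smooth.
Qed.

Lemma smooth_map_pair (U : set L) (f : L -> M) (h : L -> N) : open U ->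
  smooth_map C A U f -> smooth_map C B U h ->
  smooth_map C (prod_atlas A B) U (fun z => (f z, h z)).
Proof.
move=> oU sf sh; have [cf sff] := sf; have [ch shh] := sh.
split=> [z Uz|z p]; first by apply: cvg_pair; [exact: cf | exact: ch].
set W := _ `&` _.
have WE : W = (U `&` f @^-1` dom A p.1) `&` (U `&` h @^-1` dom B p.2) `&` dom C z.
  by apply/seteqP; split=> q; rewrite /W /preimage /= => H; decompose [and] H.
have oO : open (chart C z @` W).
  rewrite WE; apply: (chart_img_open hC); apply: openI; exact: smooth_map_open.
apply: smooth_row_mx => //.
  by apply: smooth_sub (sff z p.1) => _ [q Wq <-]; exists q => //; case: Wq => -[? ?] [].
by apply: smooth_sub (shh z p.2) => _ [q Wq <-]; exists q => //; case: Wq => -[? ?] [].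
Qed.

End Products.

(** * Naturality of the exterior derivative *)

Section Natural.
Context {R : realType} {n : nat} {M : topologicalType} {A : atlas R n M}.
Hypothesis hA : is_manifold A.
Implicit Types (a b w : form R n M).

Local Notation Eu m := (eucl_atlas R m).

(** The naturality of [d], tested on all smooth maps from open subsets of
   Euclidean spaces.  Quantifying over all of them makes the property stable
   under the operations that generate the polynomial forms, including [d], so
   that the pullback of a form of higher degree is never differentiated by
   hand. *)
Definition natural w := forall m (O : set 'rV[R]_m) (F : 'rV[R]_m -> M),
  open O -> smooth_map (Eu m) A O F ->
  smooth_form O (pullback (Eu m) A F w) /\
  forall u s, O u ->
    eucl_d (pullback (Eu m) A F w) u s = pullback (Eu m) A F (ext_d A w) u s.

Lemma eucl_d_fun m (f : 'rV[R]_m -> R) u v s :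
  eucl_d (form_of_fun f) u (v :: s) = if s is [::] then 'D_v f u else 0.
Proof.
rewrite eucl_d_cons; case: s => [|v' s].
  by rewrite eucl_d_nil subr0.
rewrite (_ : contr v (form_of_fun f) = 0) //.
rewrite eucl_d0 subr0 -[RHS](derive_cst (0 : R) u v).
by congr ('D_v _ u); apply/funext.
Qed.

Lemma in_chart_fun f x : in_chart A (form_of_fun f) x = form_of_fun (f \o chartV A x).
Proof. by apply/funext => u; apply/funext => -[]. Qed.

Lemma pullback_fun m (f : M -> R) (F : 'rV[R]_m -> M) :
  pullback (Eu m) A F (form_of_fun f) = form_of_fun (f \o F).
Proof. by apply/funext => u; apply/funext => -[]. Qed.

(** For a function, naturality of [d] is the chain rule. *)
Lemma natural_fun (f : M -> R) : smooth_fun A setT f -> natural (form_of_fun f).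
Proof.
move=> sf m O F oO sF; have hE := eucl_manifold R m.
have sfF : smooth O (f \o F).
  have := smooth_fun_comp hE hA openT oO (fun _ _ => I) sf sF => /(_ 0).
  rewrite -[X in smooth X _]/(id @` (O `&` setT)) setIT image_id.
  exact.
rewrite pullback_fun; split=> [[|v s]|u [|v s] Ou] //.
- exact: smooth_cst.
- by rewrite eucl_d_nil /pullback ext_d_chart eucl_d_nil.
rewrite eucl_d_fun /pullback ext_d_chart -in_chartE in_chart_fun /= eucl_d_fun.
case: s => [|//] /=.
pose y := F u.
have oS := smooth_map_chart_open hE hA (x := u) (y := y) oO sF.
have df : differentiable (f \o chartV A y) (chart A y y).
  apply: (smooth_differentiable _ (sf y)); last first.
    by exists y => //; split => //; exact: dom_self.
  by apply: chart_img_open => //; exact: openT.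
have dF : differentiable (chart A y \o F) u.
  exact: (smooth_map_differentiable hE hA oO sF Ou).
rewrite /tangent_map -[RHS](@derive_comp _ _ _ _ (chart A y \o F) (f \o chartV A y) u v dF df).
apply: near_eq_derive.
have oW := smooth_map_open hA y oO sF.
have Wu : (O `&` F @^-1` dom A y) u by split => //; exact: dom_self.
by apply: filterS (open_nbhs_nbhs (conj oW Wu)) => t [_ Dt] /=; rewrite (chartK hA).
Qed.

Lemma natural_derivable m (O : set 'rV[R]_m) F w u :
  natural w -> open O -> smooth_map (Eu m) A O F -> O u ->
  derivable_form u (pullback (Eu m) A F w).
Proof. by move=> nw oO sF Ou; have [sw _] := nw _ _ _ oO sF; exact: smooth_derivable_form Ou. Qed.

Lemma natural_self w p : natural w ->
  derivable_form (chart A p p) (pullback (Eu n) A (chartV A p) w).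
Proof.
move=> nw.
exact: (natural_derivable nw (chart_open hA p) (smooth_chartV hA p) (chart_self hA p)).
Qed.

Lemma ext_dD a b : natural a -> natural b -> ext_d A (a + b) = ext_d A a + ext_d A b.
Proof.
move=> na nb; apply/funext => p; apply/funext => s.
rewrite ext_d_chart pullbackD eucl_dD //; exact: natural_self.
Qed.

Lemma naturalD a b : natural a -> natural b -> natural (a + b).
Proof.
move=> na nb m O F oO sF.
have [sa da] := na _ _ _ oO sF; have [sb db] := nb _ _ _ oO sF.
split=> [|u s Ou]; first exact: smooth_formD.
rewrite ext_dD // !pullbackD eucl_dD; last 2 first.
- exact: smooth_derivable_form sa Ou.
- exact: smooth_derivable_form sb Ou.
by rewrite da // db.
Qed.

Lemma ext_d_par a : natural a -> ext_d A (parity 1 a) = - parity 1 (ext_d A a).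
Proof.
move=> na; apply/funext => p; apply/funext => s.
by rewrite ext_d_chart pullback_parity eucl_d_par //; exact: natural_self.
Qed.

(** Leibniz' rule at [p], read in the chart of index [p]. *)
Lemma ext_d_wedge a b : natural a -> natural b ->
  ext_d A (wedge a b) = wedge (ext_d A a) b + wedge (parity 1 a) (ext_d A b).
Proof.
move=> na nb; apply/funext => p; apply/funext => s.
rewrite ext_d_chart pullback_wedge eucl_d_wedge; [|exact: natural_self..].
rewrite -[RHS]/(_ + _); congr (_ + _); rewrite -[in RHS](map_id s); apply: wedge_map => t;
  rewrite map_id //.
- by rewrite -in_chartE in_chart_self.
- by rewrite /parity -in_chartE in_chart_self.
Qed.

Lemma natural_wedge a b : natural a -> natural b -> natural (wedge a b).
Proof.
move=> na nb m O F oO sF.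
have [sa da] := na _ _ _ oO sF; have [sb db] := nb _ _ _ oO sF.
split=> [|u s Ou]; first by rewrite pullback_wedge; exact: smooth_wedge.
rewrite ext_d_wedge // pullbackD !pullback_wedge eucl_d_wedge; last 2 first.
- exact: smooth_derivable_form sa Ou.
- exact: smooth_derivable_form sb Ou.
rewrite pullback_parity -[RHS]/(_ + _); congr (_ + _); apply: wedge_congr => // t; first exact: da.
exact: db.
Qed.

(** Naturality for the chart of index [p] identifies [d w] near [p] with [d] of
   the expression of [w]. *)
Lemma ext_d_d w p s : natural w -> ext_d A (ext_d A w) p s = 0.
Proof.
move=> nw; have oi := chart_open hA p; have sV := smooth_chartV hA p.
have [sw dw] := nw _ _ _ oi sV.
rewrite ext_d_chart -(eucl_d_d s oi sw (chart_self hA p)).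
apply: eucl_d_near => t; apply: filterS (open_nbhs_nbhs (conj oi (chart_self hA p))) => u iu.
by rewrite dw.
Qed.

(** Both sides vanish: [d] of a pullback of [d w] is [d d] of the pullback of
   [w], and [d d w] is [d d] of the expression of [w] in a chart. *)
Lemma natural_d w : natural w -> natural (ext_d A w).
Proof.
move=> nw m O F oO sF; have [sw dw] := nw _ _ _ oO sF; split=> [s|u s Ou].
  apply: smooth_ext oO _ (smooth_eucl_d oO sw s) => u Ou; exact: dw.
rewrite [RHS]ext_d_d // -(eucl_d_d s oO sw Ou).
apply: eucl_d_near => t; apply: filterS (open_nbhs_nbhs (conj oO Ou)) => y Oy.
by rewrite dw.
Qed.

Lemma multilinear_ext_d w : natural w -> (forall x, multilinear (w x)) ->
  forall x, multilinear (ext_d A w x).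
Proof.
move=> nw ml p; have oi := chart_open hA p; have sV := smooth_chartV hA p.
have [sw dw] := nw _ _ _ oi sV.
apply: (@multilinear_eucl_d _ _ (pullback (Eu n) A (chartV A p) w)) => [|s].
  apply: filterS (open_nbhs_nbhs (conj oi (chart_self hA p))) => u iu.
  exact: (multilinear_pullback (eucl_manifold R n) hA oi sV iu (ml _)).
exact: smooth_differentiable oi (sw s) (chart_self hA p).
Qed.

Lemma adjacent_alt_ext_d w : (forall x, adjacent_alt (w x)) ->
  forall x, adjacent_alt (ext_d A w x).
Proof.
move=> al p; have oi := chart_open hA p.
apply: (@adjacent_alt_eucl_d _ _ (pullback (Eu n) A (chartV A p) w)).
apply: filterS (open_nbhs_nbhs (conj oi (chart_self hA p))) => u iu.
exact: adjacent_alt_pullback.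
Qed.

Lemma smooth_form_cst m (O : set 'rV[R]_m) (c : R) :
  smooth_form O (form_of_fun (fun=> c)).
Proof. by move=> [|v s]; exact: smooth_cst. Qed.

Section PullbackMap.
Context {m : nat} {N : topologicalType} {B : atlas R m N}.
Hypothesis hB : is_manifold B.
Context {U : set N} {g : N -> M} {w : form R n M}.
Hypotheses (oU : open U) (sg : smooth_map B A U g) (nw : natural w).

Let hE := eucl_manifold R m.

Lemma smooth_chartV_on p : smooth_map (Eu m) B (chart B p @` (U `&` dom B p)) (chartV B p).
Proof.
apply: smooth_map_sub (smooth_chartV hB p); rewrite chart_imgE //; exact: subIsetl.
Qed.

Lemma smooth_map_chartV p :
  smooth_map (Eu m) A (chart B p @` (U `&` dom B p)) (g \o chartV B p).
Proof.
have VU u : (chart B p @` (U `&` dom B p)) u -> U (chartV B p u).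
  by rewrite chart_imgE // => -[].
have oO := chart_img_open hB (x := p) oU.
have H := smooth_map_comp hE hB hA oO oU VU (smooth_chartV_on p) sg.
exact: H.
Qed.

(** The expression in a chart of a constant minus a pullback. *)
Lemma in_chart_cst_sub c p u s : (chart B p @` (U `&` dom B p)) u ->
  in_chart B (form_of_fun (fun=> c) - pullback B A g w) p u s
  = (form_of_fun (fun=> c) - pullback (Eu m) A (g \o chartV B p) w) u s.
Proof.
move=> Ou; have oO := chart_img_open hB (x := p) oU.
have VU y : (chart B p @` (U `&` dom B p)) y -> U (chartV B p y).
  by rewrite chart_imgE // => -[].
have H := pullback_comp hE hB hA oO oU VU (smooth_chartV_on p) sg w Ou.
rewrite -[RHS]/(form_of_fun (fun=> c) u s - pullback (Eu m) A (g \o chartV B p) w u s) H.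
rewrite in_chartE -[LHS]/(pullback (Eu m) B (chartV B p) (form_of_fun (fun=> c)) u s - _).
by case: s.
Qed.

Lemma smooth_cst_sub c p : smooth_form (chart B p @` (U `&` dom B p))
  (form_of_fun (fun=> c) - pullback (Eu m) A (g \o chartV B p) w).
Proof.
have oO := chart_img_open hB (x := p) oU.
have [sw _] := nw oO (smooth_map_chartV p).
by apply: smooth_formD oO (smooth_form_cst _ c) (smooth_formN oO sw).
Qed.

(** Naturality of [d] for a map between manifolds, obtained from naturality for
   its composite with the inverse of a chart.  The constant, which [d] kills, is
   the one that occurs in the twisting cochain. *)
Lemma ext_d_cst_sub c p s : U p ->
  ext_d B (form_of_fun (fun=> c) - pullback B A g w) p s = - pullback B A g (ext_d A w) p s.
Proof.
move=> Up; have oO := chart_img_open hB (x := p) oU.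
have Op : (chart B p @` (U `&` dom B p)) (chart B p p).
  by exists p => //; split => //; exact: dom_self.
have [sw dw] := nw oO (smooth_map_chartV p).
rewrite (pullback_chart hB) -dw // -(eucl_dN _ (smooth_derivable_form oO sw Op)).
rewrite -[RHS]add0r.
have -> : 0 = eucl_d (form_of_fun (fun=> c)) (chart B p p) s.
  case: s => [|v [|v' s]]; rewrite ?eucl_d_nil // eucl_d_fun //.
  by rewrite (derive_cst (c : R)).
rewrite -eucl_dD; last 2 first.
- exact: smooth_derivable_form oO (smooth_form_cst _ c) Op.
- exact: derivable_formN (smooth_derivable_form oO sw Op).
rewrite ext_d_chart; apply: eucl_d_near => t.
apply: filterS (open_nbhs_nbhs (conj oO Op)) => u Ou.
by rewrite -in_chartE in_chart_cst_sub.
Qed.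

End PullbackMap.

End Natural.

(** * The coproduct of polynomial forms *)

Section PolynomialForms.
Context {R : realType} {n N : nat} {G : spaceGroupType}.
Variables (A : atlas R n G) (rho : G -> 'M[R]_N).
Hypotheses (hG : is_lie_group A) (hrho : is_algebraic A rho).
Implicit Types (w : form R n G).

Let hA : is_manifold A := lie_manifold hG.

Lemma det_rho_neq0 x : \det (rho x) != 0.
Proof.
have : \det (rho x) * \det (rho x^-1%g) = 1.
  by rewrite -det_mulmx -(algebraicM hrho) mulgV (algebraic1 hrho) det1.
by apply: contra_eq_neq => ->; rewrite mul0r eq_sym oner_neq0.
Qed.

Lemma smooth_polynomial m (O : set 'rV[R]_m) (F : 'rV[R]_m -> 'M[R]_N) p :
  open O -> smooth O F -> polynomial_fun p -> smooth O (p \o F).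
Proof.
move=> oO sF pp k; elim: pp => [c|i j|{}p q _ IHp _ IHq|{}p q _ IHp _ IHq].
- exact: Ck_cst.
- exact: ((Ck_mxP _ _ oO).1 (sF k)).
- exact: (Ck_add oO IHp IHq).
- exact: (Ck_mul oO IHp IHq).
Qed.

Lemma smooth_regular f : regular rho f -> smooth_fun A setT f.
Proof.
move=> [p [d [pp fE]]] x; set O := _ @` _.
have oO : open O by apply: chart_img_open => //; exact: openT.
have sr : smooth O (rho \o chartV A x) := algebraic_smooth hrho x.
have srk k := (Ck_mxP _ _ oO).1 (sr k).
apply: (@smooth_ext _ _ _ _ (fun u => p (rho (chartV A x u)) * (\det (rho (chartV A x u)) ^+ d)^-1)) => //.
  by move=> u _ /=; rewrite fE.
move=> k; apply: Ck_mul => //; first exact: (smooth_polynomial oO sr pp k).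
apply: Ck_inv => //; first by move=> u _; rewrite expf_neq0 // det_rho_neq0.
apply: Ck_exp => //; apply: Ck_sum => // s; apply: Ck_mul => //; first exact: Ck_cst.
by apply: Ck_prod => // i; exact: srk.
Qed.

(** The reason for [natural]: it follows the inductive definition. *)
Lemma polynomial_natural w : polynomial_form A rho w -> natural (A := A) w.
Proof.
elim=> [f rf|a b _ na _ nb|a b _ na _ nb|a _ na].
- exact/natural_fun/smooth_regular.
- exact: naturalD.
- exact: natural_wedge.
- exact: natural_d.
Qed.

Lemma polynomial_alternating w : polynomial_form A rho w ->
  forall x, multilinear (w x) /\ adjacent_alt (w x).
Proof.
elim=> [f rf|a b _ ha _ hb|a b _ ha _ hb|a pa ha] x.
- split; first by move=> [|? ?] s2 k u v /=; rewrite mulr0 addr0.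
  by move=> [|? ?].
- have [ma aa] := ha x; have [mb ab] := hb x; split=> [s1 s2 k u v|s1 s2 u].
    by rewrite -![(a + b) x _]/(_ + _) ma mb; ring.
  by rewrite -[(a + b) x _]/(_ + _) aa ab addr0.
- have [ma aa] := ha x; have [mb ab] := hb x.
  by split; [exact: multilinear_wedge | exact: adjacent_alt_wedge].
- split.
    by apply: multilinear_ext_d => //; [exact: polynomial_natural | move=> y; have [] := ha y].
  by apply: adjacent_alt_ext_d => // y; have [] := ha y.
Qed.

Lemma regular_cst (c : R) : regular rho (fun=> c).
Proof. by exists (fun=> c), 0%N; split=> [|x]; [exact: Poly_cst | rewrite expr0 divr1]. Qed.

Lemma polynomialZ k w : polynomial_form A rho w -> polynomial_form A rho (k *: w).
Proof.
move=> pw; have -> : k *: w = wedge (form_of_fun (fun=> k)) w.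
  by apply/funext => x; apply/funext => s; rewrite wedge_fun.
by apply: Pform_wedge => //; apply: Pform_fun; exact: regular_cst.
Qed.

Lemma polynomial_par w : polynomial_form A rho w -> polynomial_form A rho (parity 1 w).
Proof.
elim=> [f rf|a b _ ha _ hb|a b _ ha _ hb|a pa ha].
- by rewrite par_fun; exact: Pform_fun.
- by rewrite parD; exact: Pform_add.
- by rewrite par_wedge; exact: Pform_wedge.
- have -> : parity 1 (ext_d A a) = -1 *: ext_d A (parity 1 a).
    by rewrite (ext_d_par hA (polynomial_natural pa)) scaleN1r opprK.
  by apply: polynomialZ; exact: Pform_d.
Qed.

Lemma polynomial_even w : polynomial_form A rho w -> polynomial_form A rho (even_part w).
Proof. by move=> pw; apply: polynomialZ; apply: Pform_add => //; exact: polynomial_par. Qed.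

Lemma polynomial_odd w : polynomial_form A rho w -> polynomial_form A rho (odd_part w).
Proof.
move=> pw; apply: polynomialZ; rewrite -scaleN1r; apply: Pform_add => //.
exact/polynomialZ/polynomial_par.
Qed.

(** The entries of a product of matrices are sums of products of entries. *)
Lemma polynomial_mulmx (p : 'M[R]_N -> R) : polynomial_fun p ->
  exists s : seq (('M[R]_N -> R) * ('M[R]_N -> R)),
    (forall t, t \in s -> polynomial_fun t.1 /\ polynomial_fun t.2) /\
    forall a b, p (a *m b) = \sum_(t <- s) t.1 a * t.2 b.
Proof.
elim=> [c|i j|{}p q _ [s [ps sE]] _ [r [pr rE]]|{}p q _ [s [ps sE]] _ [r [pr rE]]].
- exists [:: (fun=> c, fun=> 1)]; split=> [t|a b]; last by rewrite big_seq1 mulr1.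
  by rewrite inE => /eqP ->; split; exact: Poly_cst.
- exists [seq (fun a : 'M[R]_N => a i k, fun a : 'M[R]_N => a k j) | k <- enum 'I_N].
  split=> [_ /mapP[k _ ->]|a b]; first by split; exact: Poly_coord.
  by rewrite mxE big_map big_enum.
- exists (s ++ r); split=> [t|a b]; last by rewrite sE rE big_cat.
  by rewrite mem_cat => /orP[/ps|/pr].
- exists [seq (fun a => t.1.1 a * t.2.1 a, fun a => t.1.2 a * t.2.2 a)
         | t <- [seq (t1, t2) | t1 <- s, t2 <- r]].
  split=> [_ /mapP[_ /allpairsP[[t1 t2] [/= /ps[h1 h2] /pr[h3 h4] ->]] ->]|a b].
    by split; apply: Poly_mul.
  rewrite sE rE big_map big_allpairs mulr_suml; apply: eq_bigr => t1 _.
  by rewrite mulr_sumr; apply: eq_bigr => t2 _ /=; ring.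
Qed.

Lemma regular_mul f : regular rho f ->
  exists s : seq ((G -> R) * (G -> R)),
    (forall t, t \in s -> regular rho t.1 /\ regular rho t.2) /\
    forall x y, f (x * y)%g = \sum_(t <- s) t.1 x * t.2 y.
Proof.
move=> [p [d [pp fE]]]; have [s [ps sE]] := polynomial_mulmx pp.
exists [seq (fun x => t.1 (rho x) / \det (rho x) ^+ d, fun x => t.2 (rho x) / \det (rho x) ^+ d)
       | t <- s].
split=> [_ /mapP[t /ps[p1 p2] ->]|x y].
  by split; [exists t.1, d | exists t.2, d].
rewrite fE (algebraicM hrho) sE big_map mulr_suml; apply: eq_bigr => t _ /=.
by rewrite det_mulmx exprMn invfM; ring.
Qed.

Local Notation Eu m := (eucl_atlas R m).

(** The defining property of the coproduct, tested on pairs of smooth maps from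
   open subsets of Euclidean spaces.  Testing on all points of such subsets,
   not at one point, allows to differentiate the identity. *)
Definition splits w (s : seq (form R n G * form R n G)) :=
  (forall t, t \in s -> polynomial_form A rho t.1 /\ polynomial_form A rho t.2) /\
  forall m (O : set 'rV[R]_m) (F1 F2 : 'rV[R]_m -> G), open O ->
    smooth_map (Eu m) A O F1 -> smooth_map (Eu m) A O F2 ->
    forall u, O u -> pullback (Eu m) A (fun y => F1 y * F2 y)%g w u
      = \sum_(t <- s) wedge (pullback (Eu m) A F1 t.1) (pullback (Eu m) A F2 t.2) u.

Lemma smooth_mul l (L : topologicalType) (C : atlas R l L) (O : set L) (f1 f2 : L -> G) :
  is_manifold C -> open O -> smooth_map C A O f1 -> smooth_map C A O f2 ->
  smooth_map C A O (fun y => f1 y * f2 y)%g.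
Proof.
move=> hC oO s1 s2; have hAA := prod_manifold hA hA.
have s12 := smooth_map_pair hA hA hC oO s1 s2.
have H := smooth_map_comp hC hAA hA oO openT (fun _ _ => I) s12 (lie_mul hG).
exact: H.
Qed.

Lemma sum_formE l (L : topologicalType) (T : Type) (r : seq T) (F : T -> form R l L) x s :
  (\sum_(t <- r) F t) x s = \sum_(t <- r) F t x s.
Proof. by rewrite !fct_sumE. Qed.

Lemma pullback_even m n' (M' N' : topologicalType) (C : atlas R m M') (B : atlas R n' N') f (w' : form R n' N') :
  pullback C B f (even_part w') = even_part (pullback C B f w').
Proof. by rewrite /even_part -pullback_parity. Qed.

Lemma pullback_odd m n' (M' N' : topologicalType) (C : atlas R m M') (B : atlas R n' N') f (w' : form R n' N') :
  pullback C B f (odd_part w') = odd_part (pullback C B f w').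
Proof. by rewrite /odd_part -pullback_parity. Qed.

(** The pullback by the product of two maps is compatible with sums, wedge
   products and [d], so a decomposition is carried along the construction of a
   polynomial form: matrix multiplication gives it for functions, interchanging
   the middle factors for wedge products, Leibniz' rule for [d]. *)
Lemma splits_exists w : polynomial_form A rho w -> exists s, splits w s.
Proof.
elim=> [f rf|a b _ [s1 [p1 e1]] _ [s2 [p2 e2]]|a b _ [s1 [p1 e1]] _ [s2 [p2 e2]]|a pa [s [p e]]].
- have [s [rs sE]] := regular_mul rf.
  exists [seq (form_of_fun t.1, form_of_fun t.2) | t <- s]; split.
    by move=> _ /mapP[t /rs[r1 r2] ->]; split; exact: Pform_fun.
  move=> m O F1 F2 oO s1 s2 u Ou; apply/funext => v; rewrite big_map fct_sumE.
  under eq_bigr => t _ do rewrite !pullback_fun wedge_fun.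
  by rewrite pullback_fun /=; case: v => [|? ?] /=; rewrite ?sE // big1 // => t _; rewrite mulr0.
- exists (s1 ++ s2); split=> [t|m O F1 F2 oO sF1 sF2 u Ou].
    by rewrite mem_cat => /orP[/p1|/p2].
  by rewrite big_cat pullbackD -(e1 _ _ _ _ oO sF1 sF2 u Ou) -(e2 _ _ _ _ oO sF1 sF2 u Ou).
- pose r := [seq (t1, t2) | t1 <- s1, t2 <- s2].
  exists ([seq (wedge t.1.1 (even_part t.2.1), wedge t.1.2 t.2.2) | t <- r]
    ++ [seq (wedge t.1.1 (odd_part t.2.1), wedge (parity 1 t.1.2) t.2.2) | t <- r]).
  split=> [t|m O F1 F2 oO sF1 sF2 u Ou].
    rewrite mem_cat => /orP[] /mapP[_ /allpairsP[[t1 t2] [/= /p1[h1 h2] /p2[h3 h4] ->]] ->] /=.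
      by split; apply: Pform_wedge => //; exact: polynomial_even.
    by split; apply: Pform_wedge => //; [exact: polynomial_odd | exact: polynomial_par].
  pose P1 := pullback (Eu m) A F1; pose P2 := pullback (Eu m) A F2.
  rewrite pullback_wedge; apply/funext => v.
  rewrite (@wedge_congr _ _ _ _ (\sum_(t <- s1) wedge (P1 t.1) (P2 t.2)) _
     (\sum_(t <- s2) wedge (P1 t.1) (P2 t.2))); last 2 first.
  + by move=> z; rewrite (e1 _ _ _ _ oO sF1 sF2 u Ou) !fct_sumE.
  + by move=> z; rewrite (e2 _ _ _ _ oO sF1 sF2 u Ou) !fct_sumE.
  rewrite wedge_suml; under eq_bigr => t _ do rewrite wedge_sumr.
  rewrite big_cat !big_map !big_allpairs /= -big_split /=.
  rewrite !fct_sumE; apply: eq_bigr => t1 _.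
  rewrite -big_split /= !fct_sumE; apply: eq_bigr => t2 _.
  by rewrite wedge_interchange !pullback_wedge pullback_even pullback_odd -pullback_parity.
exists ([seq (ext_d A t.1, t.2) | t <- s] ++ [seq (parity 1 t.1, ext_d A t.2) | t <- s]).
split=> [t|m O F1 F2 oO sF1 sF2 u Ou].
  rewrite mem_cat => /orP[] /mapP[t' /p[h1 h2] ->] /=.
    by split=> //; exact: Pform_d.
  by split; [exact: polynomial_par | exact: Pform_d].
have hE := eucl_manifold R m.
have sF := smooth_mul hE oO sF1 sF2.
have [_ da] := polynomial_natural pa oO sF.
apply/funext => v; rewrite -da //.
rewrite (@eucl_d_near _ _ _ (\sum_(t <- s) wedge (pullback (Eu m) A F1 t.1) (pullback (Eu m) A F2 t.2))); last first.
  move=> z; apply: filterS (open_nbhs_nbhs (conj oO Ou)) => y Oy.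
  by rewrite (e _ _ _ _ oO sF1 sF2 y Oy) !fct_sumE.
have dn F t1 : smooth_map (Eu m) A O F -> polynomial_form A rho t1 ->
    derivable_form u (pullback (Eu m) A F t1).
  by move=> sF' /polynomial_natural nt; exact: natural_derivable nt oO sF' Ou.
rewrite eucl_d_sum => [|t /p[h1 h2]]; last by apply: derivable_wedge; exact: dn.
rewrite big_cat !big_map /= -big_split /= fct_sumE !big_seq; apply: eq_bigr => t /p[h1 h2].
rewrite eucl_d_wedge; [|exact: dn|exact: dn].
have [_ d1] := polynomial_natural h1 oO sF1.
have [_ d2] := polynomial_natural h2 oO sF2.
rewrite -pullback_parity; congr (_ + _); apply: wedge_congr => // z; first exact: d1.
exact: d2.
Qed.

(** The point [z] of the product is tested with the two components of the chart
   of index [z]. *)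
Lemma coproductP w : polynomial_form A rho w -> is_coproduct A rho w (coproduct A rho w).
Proof.
move=> pw; apply: xgetPex; have [s [ps sE]] := splits_exists pw; exists s; split=> //.
have hAA := prod_manifold hA hA.
apply/funext => z; apply/funext => v.
rewrite (pullback_chart hAA) fct_sumE fct_sumE.
have oi := chart_open hAA z; have sV := smooth_chartV hAA z.
have s1 := smooth_map_comp (eucl_manifold R _) hAA hA oi openT (fun _ _ => I) sV (smooth_map_fst hA hA setT).
have s2 := smooth_map_comp (eucl_manifold R _) hAA hA oi openT (fun _ _ => I) sV (smooth_map_snd hA hA setT).
rewrite -[_ \o _]/(fun y => (fst \o chartV (prod_atlas A A) z) y * (snd \o chartV (prod_atlas A A) z) y)%g.
rewrite (sE _ _ _ _ oi s1 s2 _ (chart_self hAA z)) fct_sumE; apply: eq_bigr => t _.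
rewrite -[in RHS](map_id v).
by apply: wedge_map => y; rewrite map_id (pullback_chart hAA).
Qed.

(** The coproduct is an identity between forms on the product of the group with
   itself; it is pulled back along the pair of [f1] and [f2]. *)
Lemma coproduct_pullback w s l (L : topologicalType) (C : atlas R l L) (O : set L) f1 f2 p v :
  is_manifold C -> open O -> smooth_map C A O f1 -> smooth_map C A O f2 -> O p ->
  is_coproduct A rho w s ->
  pullback C A (fun y => f1 y * f2 y)%g w p v
  = \sum_(t <- s) wedge (pullback C A f1 t.1) (pullback C A f2 t.2) p v.
Proof.
move=> hC oO s1 s2 Op [_ sE]; have hAA := prod_manifold hA hA.
have s12 := smooth_map_pair hA hA hC oO s1 s2.
have T2 : forall x, O x -> (@setT (G * G)%type) (f1 x, f2 x) by [].
have c0 := pullback_comp hC hAA hA oO openT T2 s12 (lie_mul hG) w Op.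
have c1 := pullback_comp hC hAA hA oO openT T2 s12 (smooth_map_fst hA hA setT) _ Op.
have c2 := pullback_comp hC hAA hA oO openT T2 s12 (smooth_map_snd hA hA setT) _ Op.
rewrite -[fun y => _]/((fun q : G * G => (q.1 * q.2)%g) \o (fun y => (f1 y, f2 y))).
rewrite c0 sE pullback_sum sum_formE; apply: eq_bigr => t _.
rewrite pullback_wedge; apply: wedge_congr => y; first by rewrite -c1.
by rewrite -c2.
Qed.

End PolynomialForms.

(** * The twisting cochain of a principal bundle *)

Section Transition.
Context {R : realType} {nG nX nP : nat} {G : spaceGroupType}.
Context {X P : topologicalType} {I : Type}.
Context {AG : atlas R nG G} {AX : atlas R nX X} {AP : atlas R nP P}.
Hypotheses (hG : is_manifold AG) (hX : is_manifold AX).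
Context {pr : P -> X} {act : G -> P -> P} {U : I -> set X}.
Context {triv : I -> P -> G * X} {trivV : I -> G * X -> P}.
Hypothesis hP : is_principal_bundle AG AX AP pr act U triv trivV.
Context {g : I -> I -> X -> G}.
Hypothesis hg : is_transition U triv trivV g.

(** Changing the trivialization from [a] to [c] can be done through [b]. *)
Lemma transition_cocycle a b c x : U a x -> U b x -> U c x ->
  g a c x = (g a b x * g b c x)%g.
Proof.
move=> Ua Ub Uc.
have prE : pr (trivV a (1%g, x)) = x by exact: (trivV_proj hP).
have e1 := hg 1%g Ua Uc; have e2 := hg 1%g Ua Ub.
have K : trivV b (triv b (trivV a (1%g, x))) = trivV a (1%g, x).
  by apply: (trivK hP); rewrite prE.
by move: e1; rewrite -K e2 (hg _ Ub Uc) => -[]; rewrite !mul1g => <-.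
Qed.

(** The transition function is the first component of [triv b] after [trivV a]
   on the unit section. *)
Lemma transition_smooth a b : smooth_map AX AG (U a `&` U b) (g a b).
Proof.
have hPm := total_manifold hP; have hGX := prod_manifold hG hX.
have oU c : open (U c) := cover_open hP c.
have oab : open (U a `&` U b) by exact: openI.
have oT : open ([set: G] `*` U a).
  rewrite (_ : _ `*` _ = snd @^-1` U a).
    by apply: open_comp => // z _; exact: cvg_snd.
  by apply/seteqP; split=> z //= [].
have opr : open (pr @^-1` U b).
  have [cp _] := proj_smooth hP.
  by apply: open_comp => // z _; exact: cp.
pose F0 (x : X) : G * X := (1%g, x).
have s0 : smooth_map AX (prod_atlas AG AX) (U a `&` U b) F0.
  exact: (smooth_map_pair hG hX hX oab (smooth_map_cst _ 1%g) (smooth_map_id hX _)).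
have s1 : smooth_map AX AP (U a `&` U b) (trivV a \o F0).
  have m1 x : (U a `&` U b) x -> ([set: G] `*` U a) (F0 x) by case.
  exact: (smooth_map_comp hX hGX hPm oab oT m1 s0 (trivV_smooth hP a)).
have s2 : smooth_map AX (prod_atlas AG AX) (U a `&` U b) (triv b \o (trivV a \o F0)).
  have m2 x : (U a `&` U b) x -> (pr @^-1` U b) ((trivV a \o F0) x).
    by move=> [Ua Ub]; rewrite /preimage /= (trivV_proj hP).
  exact: (smooth_map_comp hX hPm hGX oab opr m2 s1 (triv_smooth hP b)).
have s3 := smooth_map_comp hX hGX hG oab openT (fun _ _ => Logic.I) s2 (smooth_map_fst hG hX setT).
apply: (smooth_map_ext hX hG oab _ s3) => x [Ua Ub].
by rewrite /= (hg 1%g Ua Ub) /= mul1g.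
Qed.

End Transition.

Section CechComplex.
Context {R : realType} {nG nX N : nat} {G : spaceGroupType}.
Context {X : topologicalType} {disp : Order.disp_t} {I : finOrderType disp}.
Context {AG : atlas R nG G} {rho : G -> 'M[R]_N}.
Context {AX : atlas R nX X} {U : I -> set X} {g : I -> I -> X -> G}.
Hypotheses (hG : is_lie_group AG) (hrho : is_algebraic AG rho) (hX : is_manifold AX).
Hypothesis oU : forall a, open (U a).
Hypothesis sg : forall a b, smooth_map AX AG (U a `&` U b) (g a b).
Hypothesis gM : forall a b c x, U a x -> U b x -> U c x -> g a c x = (g a b x * g b c x)%g.
Implicit Types (w : form R nG G) (t : seq I) (a b c : I) (x : X).

Local Notation phi := (phi_P AG AX U g).
Local Notation hAG := (lie_manifold hG).

Lemma phi_size w t : size t != 2 -> phi w t = 0.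
Proof. by case: t => [|a [|b []]]. Qed.

Lemma phi_simplex w t : ~~ is_simplex t -> phi w t = 0.
Proof.
case: t => [|a [|b [|? ?]]] //=; rewrite /is_simplex /= andbT.
by case: ifP.
Qed.

Lemma phi_edge w a b x s : (a < b)%O -> U a x -> U b x ->
  phi w [:: a; b] x s = (form_of_fun (fun=> counit w) - pullback AX AG (g a b) w) x s.
Proof. by move=> ab Ua Ub; rewrite /phi_P ab /restrict indicE mem_set ?mul1r. Qed.

Lemma phi_outside w a b x s : ~ (U a `&` U b) x -> phi w [:: a; b] x s = 0.
Proof.
by move=> nU; rewrite /phi_P; case: ifP => // _; rewrite /restrict indicE memNset ?mul0r.
Qed.

Lemma phi_linear (k : R) w1 w2 : phi (k *: w1 + w2) = k *: phi w1 + phi w2.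
Proof.
apply/funext => t; apply/funext => x; apply/funext => s.
rewrite -[RHS]/(k * phi w1 t x s + phi w2 t x s).
case: t => [|a [|b [|? ?]]] /=; rewrite ?mulr0 ?addr0 //.
case: ifP => _; last by rewrite mulr0 addr0.
rewrite /restrict.
rewrite -[(form_of_fun _ - _) x s]/(form_of_fun (fun=> counit (k *: w1 + w2)) x s
   - (k * pullback AX AG (g a b) w1 x s + pullback AX AG (g a b) w2 x s)).
rewrite -[(form_of_fun (fun=> counit w1) - _) x s]/(form_of_fun (fun=> counit w1) x s
   - pullback AX AG (g a b) w1 x s).
rewrite -[(form_of_fun (fun=> counit w2) - _) x s]/(form_of_fun (fun=> counit w2) x s
   - pullback AX AG (g a b) w2 x s).
have -> : form_of_fun (fun=> counit (k *: w1 + w2)) x s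
   = k * form_of_fun (fun=> counit w1) x s + form_of_fun (fun=> counit w2) x s :> R.
  by case: s => [|? ?] //=; rewrite mulr0 addr0.
ring.
Qed.

Lemma phi_unit : phi (form_of_fun (fun=> 1)) = 0.
Proof.
apply/funext => t; apply/funext => x; apply/funext => s.
case: t => [|a [|b [|? ?]]] //=; case: ifP => // _; rewrite /restrict.
rewrite -[(_ - _) x s]/(form_of_fun (fun=> counit (form_of_fun (fun=> 1))) x s
   - pullback AX AG (g a b) (form_of_fun (fun=> 1)) x s).
by case: s => [|? ?]; rewrite /pullback /counit /= subrr mulr0.
Qed.

Lemma overlap_edge a b : overlap U [:: a; b] = U a `&` U b.
Proof.
apply/seteqP; split=> [x H|x [Ua Ub] c]; first by split; apply: H; rewrite !inE eqxx ?orbT.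
by rewrite !inE => /orP[] /eqP ->.
Qed.

Lemma is_form0 (O : set X) : is_form AX O (0 : form R nX X).
Proof.
split=> // [x s1 s2 k u v|x s]; first by rewrite mulr0 addr0.
rewrite (_ : (fun _ => _) = (fun=> 0)) //; exact: smooth_cst.
Qed.

Lemma form_of_fun_cat (f : X -> R) x s1 s2 (u : 'rV[R]_nX) :
  form_of_fun f x (s1 ++ u :: s2) = 0 :> R.
Proof. by case: s1. Qed.

Lemma phi_edge_form w a b : polynomial_form AG rho w -> (a < b)%O ->
  is_form AX (U a `&` U b) (phi w [:: a; b]).
Proof.
move=> pw ab; have oab : open (U a `&` U b) by exact: openI.
have H x : (U a `&` U b) x -> multilinear (phi w [:: a; b] x) /\ adjacent_alt (phi w [:: a; b] x).
  move=> [Ua Ub]; have [ml al] := polynomial_alternating hG hrho pw (g a b x).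
  have mp := multilinear_pullback hX hAG oab (sg a b) (conj Ua Ub) ml.
  have ap := adjacent_alt_pullback (A := AX) (B := AG) (f := g a b) (p := x) al.
  split=> [s1 s2 k u v|s1 s2 u]; rewrite !phi_edge //.
    rewrite -![(_ - _) x _]/(_ - pullback AX AG (g a b) w x _) mp.
    by rewrite !form_of_fun_cat !sub0r opprD mulrN.
  rewrite -![(_ - _) x _]/(_ - pullback AX AG (g a b) w x _) ap.
  by rewrite form_of_fun_cat subr0.
split=> [x s|x s1 s2 k u v|x s1 s2 s3 u|x s].
- exact: phi_outside.
- have [Uab|nU] := pselect ((U a `&` U b) x); last by rewrite !phi_outside // mulr0 addr0.
  by have [ml _] := H x Uab; rewrite ml.
- have [Uab|nU] := pselect ((U a `&` U b) x); last by rewrite phi_outside.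
  have [ml al] := H x Uab; exact: alternating_adjacent.
have nw := polynomial_natural hG hrho pw.
have sc := smooth_cst_sub hAG hX oab (sg a b) nw (counit w) x s.
have oO := chart_img_open hX (x := x) oab.
apply: smooth_ext oO _ sc => u Ou; rewrite -(in_chart_cst_sub hAG hX oab (sg a b) (counit w) s Ou).
have [Ua Ub] : (U a `&` U b) (chartV AX x u) by move: Ou; rewrite chart_imgE // => -[].
by rewrite /in_chart phi_edge.
Qed.

Lemma phi_degree q w : polynomial_form AG rho w -> is_homogeneous q w ->
  is_cochain AX U q.+1 (phi w).
Proof.
move=> pw hw; split=> [t|t st]; first exact: phi_simplex.
have [|n2] := eqVneq (size t) 2; last first.
  by rewrite phi_size //; split=> //; exact: is_form0.
case: t st => [|a [|b [|? ?]]] // st _.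
have ab : (a < b)%O by move: st; rewrite /is_simplex /= andbT.
rewrite overlap_edge; split=> [|x s sq]; first exact: phi_edge_form.
have [[Ua Ub]|nU] := pselect ((U a `&` U b) x); last by rewrite phi_outside.
rewrite phi_edge // -[LHS]/(_ - pullback AX AG (g a b) w x s).
rewrite /pullback hw; last by rewrite size_map -eqSS -add1n.
by rewrite subr0; case: s sq => //= sq; rewrite /counit hw.
Qed.

Lemma ext_d0 : ext_d AX (0 : form R nX X) = 0.
Proof.
apply/funext => x; apply/funext => s; rewrite /ext_d big1 // => k _.
by rewrite (derive_cst (0 : R)) mulr0.
Qed.

Lemma restrict0 (O : set X) : restrict O (0 : form R nX X) = 0.
Proof. by apply/funext => x; apply/funext => s; rewrite /restrict mulr0. Qed.

Lemma size_omit (T : Type) k (t : seq T) : (k < size t)%N -> size (omit k t) = (size t).-1.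
Proof.
move=> kt; rewrite /omit size_cat size_takel ?size_drop; last exact: ltnW.
by rewrite subnS; lia.
Qed.

Lemma delta_size w t : size t != 3 -> cech_delta U (phi w) t = 0.
Proof.
move=> t3; rewrite /cech_delta; case: ifP => // _.
rewrite big1 ?restrict0 // => i _; rewrite phi_size ?scaler0 // size_omit //.
by apply: contra t3; case: (size t) => // n /eqP /= ->.
Qed.

Lemma cup_size w1 w2 t : size t != 3 -> cup U (phi w1) (phi w2) t = 0.
Proof.
move=> t3; rewrite /cup big1 ?restrict0 // => p _.
have [p1|p1] := eqVneq (p : nat) 1%N; last first.
  rewrite phi_size ?wedge0l // size_takel //.
have -> : phi w2 (drop p t) = 0.
  apply: phi_size; rewrite size_drop p1; apply: contra t3 => /eqP h; apply/eqP; lia.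
have -> : parity p (0 : form R nX X) = 0.
  by apply/funext => x; apply/funext => s; rewrite /parity mulr0.
exact: wedge0r.
Qed.

Lemma sum_cochainE (T : Type) (r : seq T) (F : T -> cochain) t :
  (\sum_(i <- r) F i) t = \sum_(i <- r) F i t :> form R nX X.
Proof. by rewrite fct_sumE. Qed.

(** On an edge the twisting equation is the naturality of [d]: the constant is
   closed, and the counit vanishes on exact forms. *)
Lemma twisting_edge w a b x s : polynomial_form AG rho w -> (a < b)%O ->
  restrict (overlap U [:: a; b]) (ext_d AX (phi w [:: a; b])) x s
  = phi (ext_d AG w) [:: a; b] x s.
Proof.
move=> pw ab; have oab : open (U a `&` U b) by exact: openI.
rewrite overlap_edge /restrict indicE.
have [[Ua Ub]|nU] := pselect ((U a `&` U b) x); last first.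
  by rewrite memNset // mul0r phi_outside.
rewrite mem_set ?mul1r // phi_edge //.
rewrite (@ext_d_near _ _ _ _ hX _ (form_of_fun (fun=> counit w) - pullback AX AG (g a b) w)
  (U a `&` U b)) //; last first.
  by move=> y [Uay Uby]; apply/funext => z; rewrite phi_edge.
rewrite (ext_d_cst_sub hAG hX oab (sg a b) (polynomial_natural hG hrho pw)) //.
have -> : counit (ext_d AG w) = 0 by rewrite /counit /ext_d big_ord0.
rewrite -[RHS]/(form_of_fun (fun=> 0) x s - pullback AX AG (g a b) (ext_d AG w) x s).
by case: s => [|? ?]; rewrite /= sub0r.
Qed.

Lemma tangent_cst (c : G) x v : tangent_map AX AG (fun=> c) x v = 0.
Proof. exact: derive_cst. Qed.

(** The tangent map of a constant map is zero, so a multilinear form keeps only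
   its component of degree 0. *)
Lemma pullback_unit w x s : polynomial_form AG rho w ->
  pullback AX AG (fun=> 1%g) w x s = form_of_fun (fun=> counit w) x s.
Proof.
move=> /(polynomial_alternating hG hrho) /(_ 1%g) [ml _].
case: s => [//|v s]; rewrite /pullback /= tangent_cst.
exact: (multilinear0 [::] _ ml).
Qed.

Lemma counit_par w : counit (parity 1 w) = counit w.
Proof. by rewrite /counit /parity muln0 expr0 mul1r. Qed.

Lemma overlap_triangle a b c x :
  overlap U [:: a; b; c] x <-> [/\ U a x, U b x & U c x].
Proof.
split=> [H|[Ua Ub Uc] d]; first by split; apply: H; rewrite !inE eqxx ?orbT.
by rewrite !inE => /orP[/eqP ->|/orP[] /eqP ->].
Qed.

(** Expanding the wedge products gives four sums.  As the counit is the pullback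
   by the constant map at the unit, each of them evaluates the coproduct on a
   pair of maps, chosen among the transition functions and that constant map. *)
Lemma coproduct_transition w a b c x s : polynomial_form AG rho w ->
  U a x -> U b x -> U c x ->
  \sum_(t <- coproduct AG rho w)
    wedge (form_of_fun (fun=> counit t.1) - pullback AX AG (g a b) t.1)
          (form_of_fun (fun=> counit t.2) - pullback AX AG (g b c) t.2) x s
  = form_of_fun (fun=> counit w) x s - pullback AX AG (g b c) w x s
    - pullback AX AG (g a b) w x s + pullback AX AG (g a c) w x s.
Proof.
move=> pw Ua Ub Uc; have cP := coproductP hG hrho pw; have [cp _] := cP.
pose O := U a `&` U b `&` U c.
have oO : open O by apply: openI => //; exact: openI.
have Ox : O x by [].
have sab : smooth_map AX AG O (g a b).
  by apply: smooth_map_sub (sg a b) => y [[? ?] ?].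
have sbc : smooth_map AX AG O (g b c).
  by apply: smooth_map_sub (sg b c) => y [[? ?] ?].
have s1 : smooth_map AX AG O (fun=> 1%g) by exact: smooth_map_cst.
have e := pullback_unit x s pw.
have m1 (f : X -> G) : (fun y : X => (f y * 1)%g) = f by apply/funext => y; rewrite mulg1.
have m2 (f : X -> G) : (fun y : X => (1 * f y)%g) = f by apply/funext => y; rewrite mul1g.
have h11 := coproduct_pullback hG s hX oO s1 s1 Ox cP.
have h1b := coproduct_pullback hG s hX oO s1 sbc Ox cP.
have ha1 := coproduct_pullback hG s hX oO sab s1 Ox cP.
have hab := coproduct_pullback hG s hX oO sab sbc Ox cP.
rewrite m1 in h11; rewrite m1 in ha1; rewrite m2 in h1b.
have hac : pullback AX AG (g a c) w x = pullback AX AG (fun y => g a b y * g b c y)%g w x.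
  by apply: (pullback_ext hX w oO Ox) => y [[? ?] ?]; exact: gM.
rewrite -e hac h11 h1b ha1 hab -!sumrB -big_split /= !big_seq.
apply: eq_bigr => t /cp[p1 p2].
rewrite wedgeDl !wedgeDr !wedgeNl !wedgeNr.
rewrite -[LHS]/((wedge (form_of_fun (fun=> counit t.1)) (form_of_fun (fun=> counit t.2)) x s
  - wedge (form_of_fun (fun=> counit t.1)) (pullback AX AG (g b c) t.2) x s)
  + (- wedge (pullback AX AG (g a b) t.1) (form_of_fun (fun=> counit t.2)) x s
  - - wedge (pullback AX AG (g a b) t.1) (pullback AX AG (g b c) t.2) x s)).
have u1 z := pullback_unit x z p1; have u2 z := pullback_unit x z p2.
have e3 := wedge_congr s u1 u2.
have e4 := wedge_congr s (fun z => erefl (pullback AX AG (g a b) t.1 x z)) u2.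
have e5 := wedge_congr s u1 (fun z => erefl (pullback AX AG (g b c) t.2 x z)).
have alg (h k l m : R) : (h - k) + (- l - - m) = h - k - l + m by ring.
apply: (etrans (alg _ _ _ _)).
congr (_ + _).
congr (_ - _).
congr (_ - _).
exact: esym e3.
exact: esym e5.
exact: esym e4.
Qed.

Lemma cup_triangle w1 w2 a b c : cup U (phi w1) (phi w2) [:: a; b; c]
  = restrict (overlap U [:: a; b; c])
      (wedge (phi w1 [:: a; b]) (parity 1 (phi w2 [:: b; c]))).
Proof.
rewrite /cup; congr restrict; rewrite !big_ord_recl big_ord0 addr0.
rewrite [X in X + _](_ : _ = 0) ?add0r; last by rewrite phi_size // wedge0l.
rewrite [X in _ + X](_ : _ = 0) ?addr0 //; by rewrite phi_size // wedge0l.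
Qed.

Lemma delta_triangle (h : cochain) a b c x s :
  (\sum_(i < size [:: a; b; c]) (-1) ^+ i *: h (omit i [:: a; b; c]) : form R nX X) x s
  = h [:: b; c] x s - h [:: a; c] x s + h [:: a; b] x s.
Proof.
rewrite !big_ord_recl big_ord0 addr0 /omit /= expr0 expr1 scale1r sqrrN expr1n.
rewrite scaleN1r scale1r addrA.
by [].
Qed.

(** On a triangle the signs of the convolution, of the cup product and of the
   total differential all combine to the same sign [parity 1]; what remains is
   the expansion of the coproduct. *)
Lemma twisting_triangle w a b c x s : polynomial_form AG rho w ->
  parity 1 (cech_delta U (phi w) [:: a; b; c]) x s
  = convolution AG rho U phi phi w [:: a; b; c] x s.
Proof.
move=> pw; rewrite /convolution sum_cochainE sum_formE.
under eq_bigr => t _ do rewrite cup_triangle.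
rewrite -[LHS]/((-1) ^+ (1 * size s) * cech_delta U (phi w) [:: a; b; c] x s) /cech_delta.
case: ifP => [st|ns]; last first.
  rewrite mulr0 big1 // => t _.
  have nabc : ~~ (a < b)%O || ~~ (b < c)%O.
    by rewrite -negb_and; move: ns; rewrite /is_simplex /= andbT => /negbT.
  case/orP: nabc => nab.
    by rewrite [phi _ _](_ : _ = 0) ?wedge0l ?restrict0 // phi_simplex // /is_simplex /= andbT.
  rewrite [phi t.2 _](_ : _ = 0) ?par0 ?wedge0r ?restrict0 //.
  by rewrite phi_simplex // /is_simplex /= andbT.
have /andP[ab bc] : (a < b)%O && (b < c)%O by move: st; rewrite /is_simplex /= andbT.
have ac := lt_trans ab bc.
have [H|nH] := pselect (overlap U [:: a; b; c] x); last first.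
  by rewrite /restrict indicE memNset // mul0r mulr0 big1 // => t _; rewrite mul0r.
have [Ua Ub Uc] := (overlap_triangle a b c x).1 H.
rewrite /restrict indicE mem_set // !mul1r.
under eq_bigr => t _.
  rewrite mul1r.
  rewrite (@wedge_congr _ _ _ _ (parity 1 (form_of_fun (fun=> counit t.1) - pullback AX AG (g a b) t.1)) _
    (parity 1 (form_of_fun (fun=> counit t.2) - pullback AX AG (g b c) t.2))); last 2 first.
  - move=> z; rewrite phi_edge // counit_par pullback_parity.
    by rewrite -[in LHS](par_fun (fun=> counit t.1)) -parN -parD.
  - by move=> z; rewrite /parity phi_edge.
  rewrite -par_wedge; over.
rewrite /parity -mulr_sumr coproduct_transition // !mul1n.
rewrite delta_triangle !phi_edge //; congr (_ * _).
have alg (h k l m : R) : (h - k) - (h - l) + (h - m) = h - k - m + l by ring.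
exact: (alg (form_of_fun (fun=> counit w) x s) (pullback AX AG (g b c) w x s)
  (pullback AX AG (g a c) w x s) (pullback AX AG (g a b) w x s)).
Qed.

(** Cochains supported on edges have a coboundary and cup products supported on
   triangles, so that only edges and triangles have to be considered. *)
Lemma twisting_cochain : is_twisting_cochain AG rho AX U phi.
Proof.
split.
- by move=> k w1 w2 _ _; exact: phi_linear.
- exact: phi_degree.
- exact: phi_unit.
move=> w pw; apply/funext => t; apply/funext => x; apply/funext => s.
rewrite -[LHS]/(restrict (overlap U t) (ext_d AX (phi w t)) x s
   + parity 1 (cech_delta U (phi w) t) x s - phi (ext_d AG w) t x s
   - convolution AG rho U phi phi w t x s).
have conv0 : size t != 3 -> convolution AG rho U phi phi w t = 0.
  move=> t3; rewrite /convolution sum_cochainE big1 // => i _; exact: cup_size.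
have [t3|t3] := eqVneq (size t) 3.
  rewrite !(@phi_size _ t) ?t3 // ext_d0 restrict0.
  case: t t3 {conv0} => [|a [|b [|c [|? ?]]]] // _.
  by rewrite twisting_triangle // -[(0 : form R nX X) x s]/(0 : R) add0r subr0 subrr.
rewrite conv0 // delta_size // par0 -[(0 : form R nX X) x s]/(0 : R) addr0 subr0.
have [t2|t2] := eqVneq (size t) 2; last first.
  by rewrite !phi_size // ext_d0 restrict0 subr0.
case: t t2 {conv0 t3} => [|a [|b [|? ?]]] // _.
have [ab|nab] := boolP (a < b)%O; first by rewrite twisting_edge // subrr.
have ns : ~~ is_simplex [:: a; b] by rewrite /is_simplex /= andbT.
by rewrite !phi_simplex // ext_d0 restrict0 subr0.
Qed.

End CechComplex.

Theorem proposition10 (R : realType) (nG nX nP N : nat)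
  (G : spaceGroupType) (X P : topologicalType)
  (AG : atlas R nG G) (AX : atlas R nX X) (AP : atlas R nP P)
  (rho : G -> 'M[R]_N)
  (hG : is_lie_group AG) (hGc : compact [set: G]) (hrho : is_algebraic AG rho)
  (hX : is_manifold AX) (hXc : compact [set: X])
  (disp : Order.disp_t) (I : finOrderType disp) (U : I -> set X)
  (pr : P -> X) (act : G -> P -> P)
  (triv : I -> P -> G * X) (trivV : I -> G * X -> P)
  (hP : is_principal_bundle AG AX AP pr act U triv trivV)
  (g : I -> I -> X -> G) (hg : is_transition U triv trivV g) :
  is_twisting_cochain AG rho AX U (phi_P AG AX U g).
Proof.
apply: twisting_cochain => //.
- exact: cover_open hP.
- by move=> a b; exact: (transition_smooth (lie_manifold hG) hX hP hg a b).
- by move=> a b c x; exact: (transition_cocycle hP hg).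
Qed.
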